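(* Let $G$ be a non-empty finite simple graph without isolated vertices, and let $\mathcal{I}_G$ be the set of all non-empty induced subgraphs of $G$. Let $\rho:\mathcal{I}_G\to\mathbb{N}$ be a function such that for every $L\in\mathcal{I}_G$: (1) $\operatorname{reg}(I(L))\le \rho(L)+1$; (2) $\rho(L_1)\le\rho(L)$ for every induced subgraph $L_1$ of $L$; (3) there exists a vertex $x\in V(L)$ such that $\rho(L\setminus N_L[x])+1\le\rho(L)$. Then $\operatorname{reg}(I(G)^q)\le 2q+\rho(G)-1$ for all $q\ge 1$.
   Context: Graphs are finite and simple. For a graph $G$ on vertex set $\{x_1,\dots,x_n\}$ and a field $\mathbb{K}$, the edge ideal is $I(G)=(x_ix_j \mid \{x_i,x_j\}\in E(G))\subset\mathbb{K}[x_1,\dots,x_n]$ (standard grading), and $\operatorname{reg}(-)$ is the Castelnuovo-Mumford regularity. $N_L(x)$ is the set of neighbours of $x$ in $L$, $N_L[x]=N_L(x)\cup\{x\}$, and for $U\subseteq V(L)$, $L\setminus U$ is the induced subgraph of $L$ on $V(L)\setminus U$. Induced subgraphs are allowed to have isolated vertices. Conventions: ''non-empty'' means having at least one edge; for a graph without edges (possibly with no vertices) one puts $\rho=0$ and $\operatorname{reg}(I)=\operatorname{reg}(0)=1$. $\mathbb{N}=\{0,1,2,\dots\}$. *)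

(* Defs.v *)
From mathcomp Require Import all_boot all_order all_algebra.
From mathcomp Require Import mpoly.
From Stdlib Require Import ClassicalEpsilon.
Set Implicit Arguments.
Unset Strict Implicit.
Unset Printing Implicit Defensive.
Import Order.TTheory GRing.Theory Num.Theory.
Local Open Scope ring_scope.

(** * Ideals of K[x_0, ..., x_(n-1)], as predicates *)

Definition ideal_gen (K : fieldType) (n : nat) (A : {mpoly K[n]} -> Prop) :
    {mpoly K[n]} -> Prop :=
  fun f => exists (k : nat) (c g : 'I_k -> {mpoly K[n]}),
    (forall i, A (g i)) /\ f = \sum_(i < k) c i * g i.

Definition ideal_pow (K : fieldType) (n : nat) (I : {mpoly K[n]} -> Prop)
    (q : nat) : {mpoly K[n]} -> Prop :=
  ideal_gen (fun f => exists g : 'I_q -> {mpoly K[n]},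
    (forall i, I (g i)) /\ f = \prod_(i < q) g i).

(** * Castelnuovo-Mumford regularity *)

(** The sequence  ... -> F_2 -> F_1 -> F_0 -> S  over S = K[x_0, ..., x_(n-1)],
    where F_i is the direct sum of the S(- fc_deg i a) for a < fc_rank i.
    Elements of F_i are row vectors and maps act by right multiplication. *)
Record free_complex (K : fieldType) (n : nat) := FreeComplex {
  fc_rank : nat -> nat;
  fc_deg : forall i : nat, 'I_(fc_rank i) -> int;
  fc_diff : forall i : nat, 'M[{mpoly K[n]}]_(fc_rank i.+1, fc_rank i);
  fc_aug : 'cV[{mpoly K[n]}]_(fc_rank 0)
}.

(** The maps are homogeneous of degree 0: the (a, b) entry of F_(i+1) -> F_i is
    a form of degree fc_deg i.+1 a - fc_deg i b (0 if this is negative). *)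
Definition fc_graded (K : fieldType) (n : nat) (F : free_complex K n) : Prop :=
  (forall a (m : 'X_{1..n}),
     m \in msupp (fc_aug F a ord0) -> (mdeg m)%:Z = fc_deg a) /\
  (forall i (a : 'I_(fc_rank F i.+1)) (b : 'I_(fc_rank F i)) (m : 'X_{1..n}),
     m \in msupp (fc_diff F i a b) -> (mdeg m)%:Z = fc_deg a - fc_deg b).

Definition fc_resolves (K : fieldType) (n : nat) (I : {mpoly K[n]} -> Prop)
    (F : free_complex K n) : Prop :=
  [/\ forall f, I f <-> exists v : 'rV_(fc_rank F 0), f = (v *m fc_aug F) 0 0,
      forall v : 'rV_(fc_rank F 0),
        v *m fc_aug F = 0 <-> exists w, v = w *m fc_diff F 0
    & forall i (v : 'rV_(fc_rank F i.+1)),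
        v *m fc_diff F i = 0 <-> exists w, v = w *m fc_diff F i.+1].

(** The image of F_(i+1) lies in (x_0, ..., x_(n-1)) F_i. *)
Definition fc_minimal (K : fieldType) (n : nat) (F : free_complex K n) : Prop :=
  forall i (a : 'I_(fc_rank F i.+1)) (b : 'I_(fc_rank F i)),
    (fc_diff F i a b)@_0%MM = 0.

Definition minimal_graded_free_resolution (K : fieldType) (n : nat)
    (I : {mpoly K[n]} -> Prop) (F : free_complex K n) : Prop :=
  [/\ fc_graded F, fc_resolves I F & fc_minimal F].

Definition graded_betti (K : fieldType) (n : nat) (F : free_complex K n)
    (i : nat) (j : int) : nat :=
  #|[set a : 'I_(fc_rank F i) | fc_deg a == j]|.

(** r = max {j - i | beta_(i,j)(I) <> 0}. *)
Definition is_regularity (K : fieldType) (n : nat) (I : {mpoly K[n]} -> Prop)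
    (r : int) : Prop :=
  exists F : free_complex K n,
    [/\ minimal_graded_free_resolution I F,
        exists (i : nat) (j : int), graded_betti F i j != 0%N /\ r = j - i%:Z
      & forall (i : nat) (j : int), graded_betti F i j != 0%N -> j - i%:Z <= r].

(** A nonzero homogeneous ideal has a minimal graded free resolution, unique up
    to isomorphism and of finite length, so exactly one r satisfies
    [is_regularity I r].  The zero ideal has regularity 1 by convention. *)
Definition reg (K : fieldType) (n : nat) (I : {mpoly K[n]} -> Prop) : int :=
  if excluded_middle_informative (exists2 f, I f & f != 0)
  then epsilon (inhabits (0 : int)) (is_regularity I)
  else 1.

(** * Graphs with vertex set 'I_n and adjacency relation e

    An induced subgraph of e is given by its set of vertices U. *)

Definition edge_ideal (K : fieldType) (n : nat) (e : rel 'I_n) :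
    {mpoly K[n]} -> Prop :=
  ideal_gen (fun f => exists i j : 'I_n, e i j /\ f = 'X_i * 'X_j).
Arguments edge_ideal K {n} e _.

(** The vertices of U are renumbered in increasing order, so that the edge ideal
    of the subgraph lives in a polynomial ring in #|U| variables. *)
Definition induced (n : nat) (e : rel 'I_n) (U : {set 'I_n}) : rel 'I_#|U| :=
  fun i j => e (enum_val i) (enum_val j).
Arguments induced {n} e U _ _.

Definition has_edge (n : nat) (e : rel 'I_n) (U : {set 'I_n}) : bool :=
  [exists x in U, exists y in U, e x y].

Definition closed_nbhd (n : nat) (e : rel 'I_n) (U : {set 'I_n}) (x : 'I_n) :
    {set 'I_n} :=
  x |: [set y in U | e x y].

(* Main.v *)
Require Import Defs.
From mathcomp Require Import all_boot all_order all_algebra.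
From mathcomp Require Import mpoly ring zify.
From Stdlib Require Import Classical ClassicalEpsilon.
Set Implicit Arguments.
Unset Strict Implicit.
Unset Printing Implicit Defensive.
Import Order.TTheory GRing.Theory Num.Theory.
Local Open Scope ring_scope.

(* Order the products of q edges by a multiplicative total order on multisets of
   edges and add them one by one, in decreasing order, to I^(q+1) until I^q is
   reached. Alternating-walk exchanges show that each successive colon ideal
   (J : m), with m the product of a multiset M of q edges, is generated by
   variables Z and by the products uv over pairs joined by a walk alternating
   between edges of G and edges of M. Since reg J <= max (reg (J : m) + deg m,
   reg (J + m)), it suffices to bound the regularity of such "walk ideals"
   T(W, M, Z), W being the vertex set, by rho W + 1.

   Let x be the vertex of W given by condition (3). When the neighbours of x are
   among the set D of vertices joined to v by alternating walks, (T : v) is again a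
   walk ideal, on a vertex set contained in W minus N[x], because a walk between two
   vertices outside D avoids D; so its regularity is at most rho W. If xb is an edge
   of M, colon successively by the vertices v joined to b through M - xb: the
   neighbours of x are then joined to v, and adding all these v makes the edge xb of
   M useless. If no edge of M contains x, colon by x, and adding x amounts to
   deleting it. The induction ends with M empty, where condition (1) applies. *)

(** * Graded maps and truncated graded resolutions *)

Section HomogeneousPolynomials.
Variables (K : fieldType) (n : nat).
Implicit Types (p w d : {mpoly K[n]}) (z e : int).

(** The degree is an integer because matrix entries have as degree a difference of generator
    degrees; for negative [z] only 0 qualifies. *)
Definition homz z p := forall m, m \in msupp p -> (mdeg m)%:Z = z.

Definition hcomp z p : {mpoly K[n]} :=
  \sum_(m <- msupp p | (mdeg m)%:Z == z) p@_m *: 'X_[m].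

Lemma mcoeff_hcomp z p m :
  (hcomp z p)@_m = if (mdeg m)%:Z == z then p@_m else 0.
Proof.
rewrite /hcomp raddf_sum /= big_mkcond /=.
have [mp|/memN_msupp_eq0 pm0] := boolP (m \in msupp p).
  rewrite (bigD1_seq m) ?msupp_uniq //= mcoeffZ mcoeffX eqxx mulr1.
  rewrite big1 ?addr0 // => i /negPf nim.
  by case: ifP => // _; rewrite mcoeffZ mcoeffX nim mulr0.
rewrite pm0 if_same big1 // => i _; case: ifP => // _.
rewrite mcoeffZ mcoeffX; case: eqP => [->|]; last by rewrite mulr0.
by rewrite pm0 mul0r.
Qed.

Lemma homzP z p :
  homz z p <-> forall m, p@_m != 0 -> (mdeg m)%:Z = z.
Proof. by split=> h m; [rewrite -mcoeff_msupp|rewrite mcoeff_msupp]; apply: h. Qed.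

Lemma homz_hcomp z p : homz z (hcomp z p).
Proof.
by apply/homzP => m; rewrite mcoeff_hcomp; case: (_ =P z) => // _; rewrite eqxx.
Qed.

Lemma hcomp_id z p : homz z p -> hcomp z p = p.
Proof.
move=> /homzP h; apply/mpolyP => m; rewrite mcoeff_hcomp.
by case: eqP => // ne; case: (eqVneq p@_m 0) => // /h.
Qed.

Lemma hcomp_sum z (I : Type) (r : seq I) (F : I -> {mpoly K[n]}) :
  hcomp z (\sum_(i <- r) F i) = \sum_(i <- r) hcomp z (F i).
Proof.
apply/mpolyP => m; rewrite mcoeff_hcomp !(raddf_sum (mcoeff m)) /=.
case: ifP => h; first by apply: eq_bigr => i _; rewrite mcoeff_hcomp h.
by rewrite big1 // => i _; rewrite mcoeff_hcomp h.
Qed.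

Lemma hcompM z e w d : homz e d -> hcomp (z + e) (w * d) = hcomp z w * d.
Proof.
move=> /homzP hd; apply/mpolyP => m; rewrite mcoeff_hcomp !mcoeffM.
case: eqP => hm.
  apply: eq_bigr => k /eqP km; rewrite mcoeff_hcomp.
  have [->|/hd hk] := eqVneq d@_(k.2) 0; first by rewrite !mulr0.
  case: eqP => // ne; case: ne.
  by apply: (@addIr _ e); rewrite -hk -PoszD -mdegD -km hk.
rewrite big1 // => k /eqP km; rewrite mcoeff_hcomp.
have [->|/hd hk] := eqVneq d@_(k.2) 0; first by rewrite !mulr0.
case: eqP => [hz|_]; last by rewrite mul0r.
by case: hm; rewrite -hz -hk -PoszD -mdegD -km.
Qed.

Lemma homz0 z : homz z 0.
Proof. by move=> m; rewrite -mpolyC0 msupp0. Qed.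

Lemma homzD z p w : homz z p -> homz z w -> homz z (p + w).
Proof.
by move=> hp hw m /msuppD_le; rewrite mem_cat => /orP[/hp|/hw].
Qed.

Lemma homzN z p : homz z p -> homz z (- p).
Proof. by move=> hp m; rewrite (perm_mem (msuppN p)) => /hp. Qed.

Lemma homzM z e p w : homz z p -> homz e w -> homz (z + e) (p * w).
Proof.
move=> hp hw m /msuppM_le /allpairsP [[a b] /= [/hp ha /hw hb ->]].
by rewrite mdegD PoszD ha hb.
Qed.

Lemma homzC (c : K) : homz 0 c%:MP.
Proof.
move=> m; rewrite msuppC; case: ifP => // _; rewrite inE => /eqP ->.
by rewrite mdeg0.
Qed.

Lemma homzX (m : 'X_{1..n}) : homz (mdeg m)%:Z 'X_[K, m].
Proof. by move=> a; rewrite msuppX inE => /eqP ->. Qed.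

(** A nonzero constant term forces degree 0, so a homogeneous entry having one is a unit. All
    cancellations of generators rest on this. *)
Lemma homz_unit z p : homz z p -> p@_0%MM != 0 -> z = 0 /\ p = (p@_0%MM)%:MP.
Proof.
move=> /homzP hp h0; have z0 : z = 0 by rewrite -(hp _ h0) mdeg0.
split=> //; apply/mpolyP => m; rewrite mcoeffC.
have [->|m0] := eqVneq m 0%MM; first by rewrite mulr1.
rewrite mulr0; have [//|/hp] := eqVneq p@_m 0.
by rewrite z0 => /eqP; rewrite eqz_nat mdeg_eq0 (negPf m0).
Qed.

End HomogeneousPolynomials.

(** * Graded submodules of free modules and the horseshoe lemma *)

Section GradedMatrices.
Variables (K : fieldType) (n : nat).
Implicit Types z : int.

Definition homM k l (dk : 'I_k -> int) (dl : 'I_l -> int)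
    (D : 'M[{mpoly K[n]}]_(k, l)) :=
  forall a b, homz (dk a - dl b) (D a b).

(** The component of degree [z] in the direct sum of the modules S(- dk j). *)
Definition vcomp k (dk : 'I_k -> int) z (v : 'rV[{mpoly K[n]}]_k) :=
  \row_j hcomp (z - dk j) (v 0 j).

Lemma vcomp_mul k l (dk : 'I_k -> int) (dl : 'I_l -> int)
    (D : 'M[{mpoly K[n]}]_(k, l)) z v :
  homM dk dl D -> vcomp dl z (v *m D) = vcomp dk z v *m D.
Proof.
move=> hD; apply/rowP => j; rewrite !mxE hcomp_sum; apply: eq_bigr => i _.
by rewrite mxE -(hcompM _ _ (hD i j)) subrKA.
Qed.

Definition submod k (N : 'rV[{mpoly K[n]}]_k -> Prop) :=
  N 0 /\ forall c u v, N u -> N v -> N (c *: u + v).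

Definition graded k (dk : 'I_k -> int) (N : 'rV[{mpoly K[n]}]_k -> Prop) :=
  forall z v, N v -> N (vcomp dk z v).

Lemma submodD k (N : 'rV[{mpoly K[n]}]_k -> Prop) u v :
  submod N -> N u -> N v -> N (u + v).
Proof. by move=> [N0 h] Nu Nv; rewrite -[u]scale1r; apply: h. Qed.

Lemma submod_mul k l (N : 'rV[{mpoly K[n]}]_k -> Prop) (w : 'rV_l)
    (D : 'M[{mpoly K[n]}]_(l, k)) :
  submod N -> (forall a, N (row a D)) -> N (w *m D).
Proof.
move=> hN hD; rewrite mulmx_sum_row.
elim/big_rec: _ => [|i x _ Nx]; first by case: hN.
by case: hN => _; apply.
Qed.

Definition ker k l (D : 'M[{mpoly K[n]}]_(k, l)) (w : 'rV[{mpoly K[n]}]_k) :=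
  w *m D = 0.

Lemma submod_ker k l (D : 'M[{mpoly K[n]}]_(k, l)) : submod (ker D).
Proof.
split=> [|c u v]; rewrite /ker ?mul0mx // mulmxDl -scalemxAl => -> ->.
by rewrite scaler0 addr0.
Qed.

Lemma vcomp0 k (dk : 'I_k -> int) z : vcomp dk z 0 = 0.
Proof.
apply/rowP => j; rewrite !mxE; apply: hcomp_id; exact: homz0.
Qed.

Lemma graded_ker k l dk dl (D : 'M[{mpoly K[n]}]_(k, l)) :
  homM dk dl D -> graded dk (ker D).
Proof. by move=> hD z v Dv; rewrite /ker -(vcomp_mul _ _ hD) Dv vcomp0. Qed.

(* [tres L r dk N]: the first [L] steps of a graded free resolution of the
   submodule [N] of the free module with generators in degrees [dk], whose
   [i]-th term is generated in degrees at most [r + i]. *)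
Fixpoint tres (L : nat) (r : int) (k : nat) (dk : 'I_k -> int)
    (N : 'rV[{mpoly K[n]}]_k -> Prop) : Prop :=
  if L is L'.+1 then
    exists p (dp : 'I_p -> int) (D : 'M[{mpoly K[n]}]_(p, k)),
      [/\ homM dp dk D, forall a, dp a <= r,
          forall v, N v <-> exists w, v = w *m D
        & tres L' (r + 1) dp (ker D)]
  else True.

Lemma eq_tres L r k (dk : 'I_k -> int) N N' :
  (forall v, N v <-> N' v) -> tres L r dk N -> tres L r dk N'.
Proof.
case: L => [|L] //= h [p [dp [D [h1 h2 h3 h4]]]].
by exists p, dp, D; split=> // v; rewrite -h.
Qed.

Lemma leq_tres L r r' k (dk : 'I_k -> int) N :
  r <= r' -> tres L r dk N -> tres L r' dk N.
Proof.
elim: L r r' k dk N => [|L IH] //= r r' k dk N rr' [p [dp [D [h1 h2 h3 h4]]]].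
exists p, dp, D; split=> // [a|]; first exact: le_trans (h2 a) rr'.
by apply: IH h4; rewrite lerD2r.
Qed.

Lemma eq_tres_deg L r k (dk dk' : 'I_k -> int) N :
  dk =1 dk' -> tres L r dk N -> tres L r dk' N.
Proof.
case: L => [|L] //= e [p [dp [D [h1 h2 h3 h4]]]].
by exists p, dp, D; split=> // a b; rewrite -e.
Qed.

Lemma tres_shift L r s k (dk : 'I_k -> int) N :
  tres L r dk N -> tres L (r + s) (fun j => dk j + s) N.
Proof.
elim: L r k dk N => [|L IH] //= r k dk N [p [dp [D [h1 h2 h3 h4]]]].
exists p, (fun j => dp j + s), D; split=> // [a b|a|].
- by rewrite opprD addrACA subrr addr0.
- by rewrite lerD2r.
- by rewrite addrAC; apply: IH.
Qed.

Lemma tres_zero L r k (dk : 'I_k -> int) : tres L r dk (fun v => v = 0).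
Proof.
elim: L r k dk => [|L IH] //= r k dk.
exists 0%N, (fun _ => 0), 0; split=> // [[]//|[]//|v|].
  split=> [->|[w ->]]; first by exists 0; rewrite mulmx0.
  by rewrite mulmx0.
apply: eq_tres (IH _ _ _) => v; rewrite /ker; split=> _.
  by rewrite mulmx0.
by apply/rowP; case.
Qed.

Lemma tres_full L r k (dk : 'I_k -> int) :
  (forall a, dk a <= r) -> tres L r dk (fun=> True).
Proof.
case: L => [|L] //= h; exists k, dk, 1%:M; split=> // [a b|v|].
- rewrite mxE; case: eqP => [->|_]; last exact: homz0.
  by rewrite subrr; apply: homzC.
- by split=> // _; exists v; rewrite mulmx1.
apply: eq_tres (tres_zero _ _ _) => v.
by rewrite /ker mulmx1.
Qed.

Definition dcat a c (da : 'I_a -> int) (dc : 'I_c -> int) (j : 'I_(a + c)) :=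
  match split j with inl i => da i | inr i => dc i end.

Lemma dcatl a c (da : 'I_a -> int) (dc : 'I_c -> int) i :
  dcat da dc (lshift c i) = da i.
Proof. by rewrite /dcat (unsplitK (inl i)). Qed.

Lemma dcatr a c (da : 'I_a -> int) (dc : 'I_c -> int) i :
  dcat da dc (rshift a i) = dc i.
Proof. by rewrite /dcat (unsplitK (inr i)). Qed.

Lemma choice_rows k l (P : 'I_k -> 'rV[{mpoly K[n]}]_l -> Prop) :
  (forall i, exists v, P i v) -> exists A : 'M_(k, l), forall i, P i (row i A).
Proof.
move=> /fin_all_exists [f hf]; exists (\matrix_(i, j) f i 0 j) => i.
suff -> : row i (\matrix_(i, j) f i 0 j) = f i by [].
by apply/rowP => j; rewrite !mxE.
Qed.

(** The horseshoe lemma for 0 -> A -> B -> C -> 0, with [A] the part of [B] in the first summand and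
    [C] the projection to the second. Lifting the generators of [C] gives a block triangular matrix,
    whose kernel is again such an extension. *)
Lemma tres_horseshoe L r a c (da : 'I_a -> int) (dc : 'I_c -> int) A B C :
  submod B -> graded (dcat da dc) B ->
  (forall u, A u <-> B (row_mx u 0)) ->
  (forall u v, B (row_mx u v) -> C v) ->
  (forall v, C v -> exists u, B (row_mx u v)) ->
  tres L r da A -> tres L r dc C -> tres L r (dcat da dc) B.
Proof.
elim: L r a c da dc A B C => [|L IH] //= r a c da dc A B C sB gB AB BC CB.
move=> [p [dp [D [hD dpr genD tD]]]] [q [dq [E [hE dqr genE tE]]]].
have [T hT] : exists T : 'M_(q, a),
    forall i, B (row_mx (row i T) (row i E)) /\
      forall j, homz (dq i - da j) (row i T 0 j).
  apply: (@choice_rows _ _ (fun i t => B (row_mx t (row i E)) /\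
      forall j, homz (dq i - da j) (t 0 j))) => i.
  have /CB [u Bu] : C (row i E).
    by apply/genE; exists (delta_mx 0 i); rewrite rowE.
  (* The component of degree [dq i] of the lift stays in the graded module [B] and leaves the
     homogeneous row of [E] unchanged. *)
  exists (vcomp da (dq i) u); split; last first.
    by move=> j; rewrite mxE; apply: homz_hcomp.
  move: (gB (dq i) _ Bu); congr B; apply/rowP => j.
  rewrite mxE; case: (split_ordP j) => j' ->.
    by rewrite !row_mxEl dcatl mxE.
  by rewrite !row_mxEr dcatr mxE hcomp_id.
have TE : forall w, B (w *m row_mx T E).
  by move=> w; apply: submod_mul => // i; rewrite row_row_mx; case: (hT i).
have A0 : forall w, B (row_mx (w *m D) 0).
  by move=> w; apply/AB/genD; exists w.
exists (p + q)%N, (dcat dp dq), (block_mx D 0 T E); split.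
- move=> i j; case: (split_ordP i) => i' ->; case: (split_ordP j) => j' ->.
  + by rewrite block_mxEul !dcatl.
  + by rewrite block_mxEur mxE; apply: homz0.
  + rewrite block_mxEdl dcatl dcatr; case: (hT i') => _ /(_ j').
    by rewrite mxE.
  + by rewrite block_mxEdr !dcatr.
- by move=> i; case: (split_ordP i) => i' ->; rewrite ?dcatl ?dcatr.
- move=> v; split=> [Bv|[w ->]].
    have [w2 hw2] : exists w, rsubmx v = w *m E.
      by apply/genE/(BC (lsubmx v)); rewrite hsubmxK.
    have [w1 hw1] : exists w, lsubmx v - w2 *m T = w *m D.
      apply/genD/AB; rewrite -scaleN1r.
      have -> : row_mx (lsubmx v + -1 *: (w2 *m T)) 0 =
                -1 *: (w2 *m row_mx T E) + v.
        rewrite -[in RHS](hsubmxK v) mul_mx_row -hw2 scale_row_mx add_row_mx.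
        by rewrite !scaleN1r addNr addrC.
      by case: sB => _; apply.
    exists (row_mx w1 w2); rewrite mul_row_block mulmx0 add0r -hw1 -hw2.
    by rewrite subrK hsubmxK.
  rewrite -[w]hsubmxK mul_row_block mulmx0 -add_row_mx -mul_mx_row.
  exact: submodD.
apply: (IH _ _ _ _ _ (ker D) _ (ker E)) => //.
- exact: submod_ker.
- apply: (graded_ker (dl := dcat da dc)) => i j.
  case: (split_ordP i) => i' ->; case: (split_ordP j) => j' ->.
  + by rewrite block_mxEul !dcatl.
  + by rewrite block_mxEur mxE; apply: homz0.
  + rewrite block_mxEdl dcatl dcatr; case: (hT i') => _ /(_ j').
    by rewrite mxE.
  + by rewrite block_mxEdr !dcatr.
- move=> u; rewrite /ker mul_row_block !mul0mx mulmx0 !addr0.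
  split=> [->|/eqP]; first by rewrite row_mx0.
  by rewrite row_mx_eq0 => /andP[/eqP].
- move=> u v; rewrite /ker mul_row_block mulmx0 add0r => /eqP.
  by rewrite row_mx_eq0 => /andP[_ /eqP].
(* Snake argument: [v *m T] lies in [A], hence equals some [u *m D], and [row_mx (- u) v] is a
   relation lifting [v]. *)
- move=> v hv; have : A (v *m T).
    by apply/AB; move: (TE v); rewrite mul_mx_row hv.
  move=> /genD [u hu]; exists (- u); rewrite /ker mul_row_block mulmx0 add0r.
  by rewrite hv mulNmx -hu addNr row_mx0.
Qed.

End GradedMatrices.

Section Minimality.
Variables (K : fieldType) (n : nat).
Local Notation S := {mpoly K[n]}.

Lemma col'_mul k l m (j : 'I_m.+1) (A : 'M[S]_(k, l)) (B : 'M[S]_(l, m.+1)) :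
  col' j (A *m B) = A *m (col' j B : 'M_(l, m)).
Proof.
by apply/matrixP => a b; rewrite !mxE; apply: eq_bigr => i _; rewrite mxE.
Qed.

(** Multiplying by [row' a 1%:M] inserts a zero coordinate at [a]. *)
Lemma mul_row' k l (w : 'rV[S]_k) a (D : 'M[S]_(k.+1, l)) :
  w *m row' a D = (w *m row' a 1%:M) *m D.
Proof.
rewrite -mulmxA; congr (_ *m _); apply/matrixP => i j; rewrite !mxE.
rewrite (bigD1 (lift a i)) //= !mxE eqxx mul1r big1 ?addr0 // => b /negPf nb.
by rewrite !mxE eq_sym nb mul0r.
Qed.

Lemma col'_rowP k (u v : 'rV[S]_k.+1) j :
  u 0 j = v 0 j -> col' j u = col' j v -> u = v.
Proof.
move=> ej e; apply/rowP => i; case: (unliftP j i) => [i'|] -> //.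
by move/rowP/(_ i'): e; rewrite !mxE.
Qed.

Lemma col'_insert k (w : 'rV[S]_k) (a : 'I_k.+1) : col' a (w *m row' a 1%:M) = w.
Proof.
apply/rowP => j; rewrite !mxE (bigD1 j) //= !mxE eqxx mulr1 big1 ?addr0 //.
by move=> i /negPf ni; rewrite !mxE (inj_eq lift_inj) ni mulr0.
Qed.

Lemma insert_row0 k (w : 'rV[S]_k) (a : 'I_k.+1) : (w *m row' a 1%:M) 0 a = 0.
Proof.
by rewrite mxE big1 // => i _; rewrite !mxE eq_sym (negPf (neq_lift _ _)) mulr0.
Qed.

Lemma insert_col' k (w : 'rV[S]_k.+1) a :
  col' a w *m row' a 1%:M = w - w 0 a *: delta_mx 0 a.
Proof.
apply: (@col'_rowP _ _ _ a); rewrite ?insert_row0 ?col'_insert.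
  by rewrite !mxE !eqxx mulr1 subrr.
apply/rowP => j; rewrite !mxE eqxx /= eq_sym (negPf (neq_lift _ _)).
by rewrite mulr0 subr0.
Qed.

(** Deleting a coordinate is injective on [N], so the generators keep the same relations and the
    rest of the resolution is unchanged. *)
Lemma tres_proj L r k (dk : 'I_k.+1 -> int) N a :
  (forall v : 'rV[S]_k.+1, N v -> col' a v = 0 -> v = 0) ->
  tres L r dk N ->
  tres L r (dk \o lift a) (fun v' => exists2 v, N v & v' = col' a v).
Proof.
case: L => [|L] //= injN [p [dp [D [hD dpr genD tD]]]].
exists p, dp, (col' a D); split=> //.
- by move=> i j; rewrite mxE; apply: hD.
- move=> v; split=> [[u /genD [w ->] ->]|[w ->]].
    by exists w; rewrite col'_mul.
  by exists (w *m D); [apply/genD; exists w|rewrite col'_mul].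
apply: eq_tres tD => w; rewrite /ker -col'_mul; split=> [->|h].
  by apply/rowP => j; rewrite !mxE.
by apply: injN h; apply/genD; exists w.
Qed.

Lemma sum_unit k (f g : 'I_k -> S) :
  (\sum_i f i * g i)@_0%MM != 0 ->
  exists i, (f i)@_0%MM != 0 /\ (g i)@_0%MM != 0.
Proof.
rewrite raddf_sum /= => h; apply: NNPP => nh; case/eqP: h.
apply: big1 => i _; rewrite rmorphM /=; apply/eqP; rewrite mulf_eq0.
apply/negP => /negP; rewrite negb_or => /andP[h1 h2].
by apply: nh; exists i.
Qed.

(** View [N] as the relations among [k.+1] generators of a module. A relation with a unit at [j]
    expresses generator [j] by the others, and the relations among those are the elements of [N]
    vanishing at [j]. Elimination with a unit pivot removes one row and one column of [D]. *)
Lemma tres_cancel L r k (dk : 'I_k.+1 -> int) N j (v0 : 'rV[S]_k.+1) :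
  N v0 -> (v0 0 j)@_0%MM != 0 -> tres L r dk N ->
  tres L r (dk \o lift j) (fun v' => exists2 v, N v /\ v 0 j = 0 & v' = col' j v).
Proof.
case: L => [|L] //= Nv0 uv0 [p [dp [D [hD dpr genD tD]]]].
have [w0 v0E] : exists w, v0 = w *m D by apply/genD.
have [a [_ Daj]] : exists i, (w0 0 i)@_0%MM != 0 /\ (D i j)@_0%MM != 0.
  by apply: sum_unit; move: uv0; rewrite v0E mxE.
have [dpa Dc] := homz_unit (hD a j) Daj.
case: p dp D hD dpr genD tD w0 v0E a Daj dpa Dc
  => [|p] dp D hD dpr genD tD w0 _ a; first by case: a.
set c := (D a j)@_0%MM => c0 /eqP; rewrite subr_eq0 => /eqP dpa Dc.
pose u : S := (c^-1)%:MP.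
have uD : u * D a j = 1 by rewrite Dc -mpolyCM mulVf.
pose E : 'M[S]_(p.+1, k.+1) := D - u *: (col j D *m row a D).
have wE m (w : 'M_(m, _)) : w *m E = w *m D - u *: (w *m col j D *m row a D).
  by rewrite mulmxBr -scalemxAr mulmxA.
have wcol (w : 'rV_p.+1) : w *m col j D *m row a D = (w *m D) 0 j *: row a D.
  apply/rowP => i; rewrite !mxE big_ord1 !mxE; congr (_ * _).
  by apply: eq_bigr => b _; rewrite mxE.
have wEa (w : 'rV_p.+1) : w *m E = (w - (u * (w *m D) 0 j) *: delta_mx 0 a) *m D.
  by rewrite wE wcol mulmxBl -scalemxAl -rowE scalerA.
have wEj (w : 'rV_p.+1) : (w *m E) 0 j = 0.
  rewrite wE wcol scalerA !mxE.
  by rewrite [u * _]mulrC -mulrA uD mulr1 subrr.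
have wE0 (w : 'rV_p.+1) : (w *m D) 0 j = 0 -> w *m E = w *m D.
  by move=> h; rewrite wE wcol h scale0r scaler0 subr0.
have rowaE : (delta_mx 0 a : 'rV_p.+1) *m E = 0.
  by rewrite wE wcol -rowE mxE scalerA uD scale1r subrr.
have colE (w : 'rV_p.+1) : col' a w *m row' a 1%:M *m E = w *m E.
  by rewrite insert_col' mulmxBl -scalemxAl rowaE scaler0 subr0.
exists p, (dp \o lift a), (row' a (col' j E)); split=> //=.
- move=> b i /=; rewrite !mxE big_ord1 !mxE; apply: homzD; first exact: hD.
  apply: homzN; rewrite -[dp _ - _]add0r; apply: homzM; first exact: homzC.
  by rewrite -(subrKA (dk j)) -{2}dpa; apply: homzM; apply: hD.
- move=> v'; split=> [[v [/genD [w ->] hj] ->]|[w' ->]].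
    by exists (col' a w); rewrite mul_row' -col'_mul colE wE0.
  rewrite mul_row' -col'_mul; set w := w' *m _.
  by exists (w *m E); split=> //; apply/genD; rewrite wEa; eexists.
(* The relations among the remaining rows are those of [D] with coordinate [a] forgotten; the unit
   pivot makes that coordinate determined by the others. *)
apply: eq_tres (@tres_proj _ _ _ _ (ker D) a _ tD) => [w'|w Dw w0'].
  split=> [[w Dw ->]|].
    rewrite /ker mul_row' -col'_mul colE wE wcol Dw mxE scale0r scaler0 subr0.
    by apply/rowP => i; rewrite !mxE.
  rewrite /ker mul_row' -col'_mul => h; set w := w' *m _ in h.
  exists (w - (u * (w *m D) 0 j) *: delta_mx 0 a).
    rewrite /ker -wEa; apply: (@col'_rowP _ _ _ j); first by rewrite wEj mxE.
    by rewrite h; apply/rowP => i; rewrite !mxE.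
  rewrite -[w' in LHS](col'_insert _ a) -/w; apply/rowP => i; rewrite !mxE.
  by rewrite eqxx /= eq_sym (negPf (neq_lift _ _)) mulr0 subr0.
have wa : w = w 0 a *: delta_mx 0 a.
  apply/eqP; rewrite -subr_eq0 -insert_col' w0'; apply/eqP/rowP => i.
  by rewrite mul0mx mxE.
have /rowP/(_ j) : w *m D = 0 by [].
rewrite wa -scalemxAl -rowE !mxE => wa0.
by rewrite -[w 0 a]mulr1 -uD mulrCA wa0 mulr0 scale0r.
Qed.

(** Modulo [N], each of the first [p] generators is a combination of the last [q]; they are
    cancelled one at a time. *)
Lemma tres_cancel_block L r p q (dp : 'I_p -> int) (dq : 'I_q -> int) N :
  (forall b, exists t : 'rV[S]_q, N (row_mx (delta_mx 0 b) t)) ->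
  tres L r (dcat dp dq) N -> tres L r dq (fun v => N (row_mx 0 v)).
Proof.
elim: p dp N => [|p IH] dp N hN tN.
  apply: (@eq_tres_deg _ _ _ _ _ (dcat dp dq)) => [i|].
    rewrite -[RHS](dcatr dp dq); congr dcat; by apply: val_inj.
  by apply: eq_tres tN => v; rewrite row_thin_mx.
have [t ht] := hN ord0.
have u0 : (row_mx (delta_mx 0 ord0 : 'rV[S]_p.+1) t 0 (lshift q ord0))@_0%MM != 0.
  by rewrite row_mxEl mxE !eqxx mcoeff1 eqxx oner_eq0.
have tN' := tres_cancel (j := lshift q (ord0 : 'I_p.+1)) ht u0 tN.
pose N' := fun v' : 'rV[S]_(p + q) => exists2 w, N w /\
  w 0 (lshift q (ord0 : 'I_p.+1)) = 0 & v' = col' (lshift q ord0) w.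
apply: (@eq_tres _ _ _ _ _ _ (fun v => N' (row_mx 0 v))) => [v|].
  split=> [[w [Nw w0] e]|Nv]; last first.
    exists (row_mx 0 v); first by split=> //; rewrite row_mxEl mxE.
    rewrite col'Kl; congr row_mx; by apply/rowP => i; rewrite !mxE.
  have e0 : (row_mx (0 : 'rV[S]_p.+1) v) 0 (lshift q ord0) = 0.
    by rewrite row_mxEl mxE.
  suff -> : row_mx 0 v = w by [].
  apply: (@col'_rowP _ _ _ (lshift q (ord0 : 'I_p.+1))).
    exact: etrans e0 (esym w0).
  rewrite -e col'Kl; congr row_mx; by apply/rowP => i; rewrite !mxE.
apply: (IH (dp \o lift ord0) N') => [b|].
  have [s hs] := hN (lift ord0 b); exists s.
  exists (row_mx (delta_mx 0 (lift ord0 b)) s).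
    by split=> //; rewrite row_mxEl mxE.
  rewrite col'Kl; congr row_mx; apply/rowP => i; rewrite !mxE.
  by rewrite (inj_eq lift_inj).
apply: eq_tres_deg tN' => i /=; case: (split_ordP i) => i' ->.
  rewrite dcatl -[RHS](dcatl dp dq (lift ord0 i')); congr dcat; by apply: val_inj.
rewrite dcatr -[RHS](dcatr dp dq); congr dcat; by apply: val_inj.
Qed.

Definition minimal_gens k (N : 'rV[S]_k -> Prop) q (D : 'M[S]_(q, k)) :=
  (forall v, N v <-> exists w, v = w *m D) /\
  (forall w, ker D w -> forall b, (w 0 b)@_0%MM = 0).

(** Compare the minimal generators [D'] with the generators [D] of the resolution, each expressed by
    the other through [T] and [T']. Minimality forces units in [T], which bounds the degrees;
    cancelling [D] among the joint generators [col_mx D D'] carries the resolution over to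
    [ker D']. *)
Lemma tres_minimal L r k (dk : 'I_k -> int) N q (dq : 'I_q -> int)
    (D' : 'M[S]_(q, k)) :
  homM dq dk D' -> minimal_gens N D' -> tres L.+1 r dk N ->
  (forall b, dq b <= r) /\ tres L (r + 1) dq (ker D').
Proof.
move=> hD' [genD' minD'] [p [dp [D [hD dpr genD tD]]]].
have [T [hT TD]] : exists T, homM dq dp T /\ D' = T *m D.
  have [T hT] : exists T : 'M_(q, p), forall i,
      (forall j, homz (dq i - dp j) (row i T 0 j)) /\ row i D' = row i T *m D.
    apply: (@choice_rows _ _ _ _ (fun i t =>
      (forall j, homz (dq i - dp j) (t 0 j)) /\ row i D' = t *m D)) => i.
    have /genD [w hw] : N (row i D').
      by apply/genD'; exists (delta_mx 0 i); rewrite rowE.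
    exists (vcomp dp (dq i) w); split.
      by move=> j; rewrite mxE; apply: homz_hcomp.
    rewrite -(vcomp_mul _ _ hD) -hw; apply/rowP => j.
    by rewrite !mxE hcomp_id.
  exists T; split=> [i j|]; first by case: (hT i) => /(_ j); rewrite mxE.
  by apply/row_matrixP => i; rewrite row_mul; case: (hT i).
have [T' TD'] : exists T', D = T' *m D'.
  have [T' hT'] : exists T' : 'M_(p, q), forall i, row i D = row i T' *m D'.
    apply: (@choice_rows _ _ _ _ (fun i t => row i D = t *m D')) => i.
    by apply/genD'/genD; exists (delta_mx 0 i); rewrite rowE.
  by exists T'; apply/row_matrixP => i; rewrite row_mul.
have dqr b : dq b <= r.
  (* Row [b] of [T *m T' - 1] is a relation of [D'], so it has no constant terms. Hence some [T b c]
     is a unit and [dq b = dp c]. *)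
  have /minD'/(_ b) : ker D' (row b (T *m T' - 1%:M)).
    by rewrite /ker -row_mul mulmxBl mul1mx -mulmxA -TD' -TD subrr row0.
  rewrite !mxE eqxx mcoeffB mcoeff1 eqxx => /eqP; rewrite subr_eq0 => /eqP h.
  have [|c [Tbc _]] := @sum_unit _ (fun c => T b c) (fun c => T' c b).
    by rewrite h oner_eq0.
  have [/eqP] := homz_unit (hT b c) Tbc.
  by rewrite subr_eq0 => /eqP ->.
split=> //.
(* Every [v] completes to a joint relation by [- (v *m T)], so the joint relations extend the whole
   free module on [D'] by [ker D]. *)
have tK : tres L (r + 1) (dcat dp dq) (ker (col_mx D D')).
  apply: (tres_horseshoe (A := ker D) (C := fun=> True)) => //.
  - exact: submod_ker.
  - apply: (graded_ker (dl := dk)) => i j.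
    by case: (split_ordP i) => i' ->; rewrite ?dcatl ?dcatr ?col_mxEu ?col_mxEd.
  - by move=> u; rewrite /ker mul_row_col mul0mx addr0.
  - move=> v _; exists (- (v *m T)).
    by rewrite /ker mul_row_col mulNmx -mulmxA -TD addNr.
  - by apply: tres_full => a; apply: le_trans (dqr a) _; rewrite lerDl.
apply: eq_tres (tres_cancel_block _ tK) => [v|b].
  by rewrite /ker mul_row_col mul0mx add0r.
exists (- row b T'); rewrite /ker mul_row_col mulNmx -rowE.
by rewrite -row_mul -TD' subrr.
Qed.

(** Generators occurring in some relation with a nonzero constant term are dropped until none is
    left. *)
Lemma minimal_gens_exists r k (dk : 'I_k -> int) N :
  tres 1 r dk N ->
  exists q (dq : 'I_q -> int) (D : 'M[S]_(q, k)),
    homM dq dk D /\ minimal_gens N D.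
Proof.
case=> p [dp [D [hD _ genD _]]].
elim: p dp D hD genD => [|p IH] dp D hD genD.
  by exists 0%N, dp, D; split=> //; split=> // w _ [].
have [min|] := classic (forall w, ker D w -> forall b, (w 0 b)@_0%MM = 0).
  by exists p.+1, dp, D.
move=> nmin; have [w0 nw0] := not_all_ex_not _ _ nmin.
have [Dw0 nb] := imply_to_and _ _ nw0; have [b /eqP w0b] := not_all_ex_not _ _ nb.
(* In the component of degree [dp b], the coefficient at [b] is a nonzero constant, hence
   invertible. *)
have [w Dw [c c0 wb]] : exists2 w, ker D w & exists2 c : K, c != 0 & w 0 b = c%:MP.
  exists (vcomp dp (dp b) w0); first exact: graded_ker hD _ _ Dw0.
  exists (w0 0 b)@_0%MM => //; rewrite mxE subrr.
  have h : (hcomp 0 (w0 0 b))@_0%MM = (w0 0 b)@_0%MM.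
    by rewrite mcoeff_hcomp mdeg0.
  have [|_ ->] := homz_unit (@homz_hcomp _ _ 0 (w0 0 b)); first by rewrite h.
  by rewrite h.
apply: (IH (dp \o lift b) (row' b D)) => [i j|v].
  by rewrite mxE; apply: hD.
rewrite genD; split=> [[u ->]|[u ->]]; last by rewrite mul_row'; eexists.
pose t : S := u 0 b * (c^-1)%:MP.
exists (col' b (u - t *: w)); rewrite mul_row' insert_col' mulmxBl -scalemxAl.
rewrite !mxE wb -mulrA -mpolyCM mulVf // mulr1 subrr scale0r subr0.
by rewrite mulmxBl -scalemxAl Dw scaler0 subr0.
Qed.

End Minimality.

(** * Monomial ideals *)

Section MonomialIdeals.
Variables (K : fieldType) (n : nat).
Local Notation S := {mpoly K[n]}.
Implicit Types (Q : 'X_{1..n} -> Prop) (f g : S) (m : 'X_{1..n}) (r : int).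

(** A monomial ideal is represented by the set of exponents of its monomials; [upset Q] makes the
    span an ideal. *)
Definition monid Q f := forall m, m \in msupp f -> Q m.

Definition upset Q := forall m m', Q m -> Q (m + m')%MM.

Lemma upset_le Q m m' : upset Q -> (m <= m')%MM -> Q m -> Q m'.
Proof. by move=> uQ le Qm; rewrite -(submK le) addmC; apply: uQ. Qed.

Definition colon Q m : 'X_{1..n} -> Prop := fun m' => Q (m + m')%MM.

Definition adjoin Q m : 'X_{1..n} -> Prop := fun m' => Q m' \/ (m <= m')%MM.

Lemma monid0 Q : monid Q 0.
Proof. by move=> m; rewrite -mpolyC0 msupp0. Qed.

Lemma monidD Q f g : monid Q f -> monid Q g -> monid Q (f + g).
Proof. by move=> hf hg m /msuppD_le; rewrite mem_cat => /orP[/hf|/hg]. Qed.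

Lemma monidM Q f g : upset Q -> monid Q f -> monid Q (g * f).
Proof.
by move=> uQ hf m /msuppM_le /allpairsP [[a b] /= [_ /hf hb ->]];
  rewrite addmC; apply: uQ.
Qed.

Lemma monid_sum Q (I : Type) (s : seq I) (P : pred I) (F : I -> S) :
  (forall i, P i -> monid Q (F i)) -> monid Q (\sum_(i <- s | P i) F i).
Proof.
by move=> h; elim/big_ind: _ => //; [apply: monid0|move=> *; apply: monidD].
Qed.

Lemma monidX Q m : monid Q 'X_[m] <-> Q m.
Proof.
split=> [|Qm m']; first by apply; rewrite msuppX inE.
by rewrite msuppX inE => /eqP ->.
Qed.

Lemma monidMX Q f m : monid Q (f * 'X_[m]) <-> monid (colon Q m) f.
Proof.
split=> h m'.
  move=> mf; apply: h; move: mf.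
  by rewrite !mcoeff_msupp mcoeffMX.
move=> /msuppM_le /allpairsP [[a b] /= [ha]]; rewrite msuppX inE => /eqP -> ->.
by rewrite addmC; apply: h.
Qed.

Lemma monidZ Q (c : K) f : monid Q f -> monid Q (c *: f).
Proof. by move=> h m /msuppZ_le; apply: h. Qed.

(** The multiplier [u] removes the terms divisible by [m]. This form supplies the lift asked for by
    [tres_horseshoe]. *)
Lemma monid_adjoin Q f m :
  monid (adjoin Q m) f <-> exists u, monid Q (u * 'X_[m] + f).
Proof.
split=> [h|[u hu] m' mf].
  exists (- \sum_(m' <- msupp f | (m <= m')%MM) f@_m' *: 'X_[m' - m]).
  rewrite {3}[f]mpolyE [X in _ + X](bigID (fun m' => (m <= m')%MM)) /= addrA.
  have -> : (- \sum_(i <- msupp f | (m <= i)%MM) f@_i *: 'X_[i - m]) * 'X_[m] =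
      - \sum_(i <- msupp f | (m <= i)%MM) f@_i *: 'X_[i].
    rewrite mulNr mulr_suml; congr (- _); apply: eq_bigr => i le.
    by rewrite -scalerAl -mpolyXD submK.
  rewrite addNr add0r big_seq_cond; apply: monid_sum => i /andP[/h].
  case=> [Qi _|->] //.
  by apply: monidZ; apply/monidX.
have [h|h] := eqVneq (u * 'X_[m] + f)@_m' 0; last first.
  by left; apply: hu; rewrite mcoeff_msupp.
right; have : m' \in msupp (u * 'X_[m]).
  move: h mf; rewrite !mcoeff_msupp mcoeffD => /eqP; rewrite addr_eq0 => /eqP ->.
  by rewrite oppr_eq0.
move=> /msuppM_le /allpairsP [[a b] /= [_]]; rewrite msuppX inE => /eqP -> ->.
exact: lem_addl.
Qed.

Lemma monid_hcomp Q z f : monid Q f -> monid Q (hcomp z f).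
Proof.
move=> h m; rewrite mcoeff_msupp mcoeff_hcomp; case: ifP => [_|_]; last first.
  by rewrite eqxx.
by rewrite -mcoeff_msupp; apply: h.
Qed.

(* [Rg Q r] says that the regularity of the ideal spanned by [Q] is at most [r],
   without reference to a minimal resolution. *)
Definition Rg Q r :=
  forall L, tres L r (fun _ : 'I_1 => 0) (fun v : 'rV[S]_1 => monid Q (v 0 0)).

Lemma eq_Rg Q Q' r : (forall m, Q m <-> Q' m) -> Rg Q r -> Rg Q' r.
Proof.
move=> h RQ L; apply: eq_tres (RQ L) => v.
by split=> hv m /hv /h.
Qed.

Lemma leq_Rg Q r r' : r <= r' -> Rg Q r -> Rg Q r'.
Proof. by move=> le RQ L; apply: leq_tres le (RQ L). Qed.

Lemma Rg_empty r : Rg (fun=> False) r.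
Proof.
move=> L; apply: eq_tres (@tres_zero _ _ _ _ _ _) => v; split=> [-> m|h].
  by rewrite mxE -mpolyC0 msupp0.
apply/rowP => j; rewrite ord1 mxE; apply: msuppnil0.
case E: (msupp _) => [//|m s]; case: (h m); by rewrite E mem_head.
Qed.

(** The kernel of the map to S/(Q) sending the generators to the [c i]. *)
Lemma submod_monid k Q (c : 'I_k -> S) :
  upset Q -> submod (fun v : 'rV[S]_k => monid Q (\sum_i v 0 i * c i)).
Proof.
move=> uQ; split=> [|a u v hu hv].
  by rewrite big1 => [|i _]; [apply: monid0|rewrite mxE mul0r].
have -> : \sum_i (a *: u + v) 0 i * c i =
          a * (\sum_i u 0 i * c i) + \sum_i v 0 i * c i.
  rewrite mulr_sumr -big_split /=; apply: eq_bigr => i _.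
  by rewrite !mxE mulrDl mulrA.
by apply: monidD => //; apply: monidM.
Qed.

Lemma graded_monid k Q (dk : 'I_k -> int) (c : 'I_k -> S) :
  (forall i, homz (dk i) (c i)) ->
  graded dk (fun v : 'rV[S]_k => monid Q (\sum_i v 0 i * c i)).
Proof.
move=> hc z v hv; have := @monid_hcomp _ z _ hv; congr monid.
rewrite hcomp_sum; apply: eq_bigr => i _; rewrite mxE -(hcompM _ _ (hc i)).
by congr hcomp; rewrite subrK.
Qed.

(* Horseshoe for 0 -> S/(Q : m)(-deg m) -> S/Q -> S/(Q + m) -> 0 presents S/Q
   with the superfluous generator m, which is then cancelled. *)
Lemma Rg_colon_adjoin Q m r : upset Q ->
  Rg (colon Q m) (r - (mdeg m)%:Z) -> Rg (adjoin Q m) r -> Rg Q r.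
Proof.
move=> uQ Rc Ra L.
pose c (i : 'I_(1 + 1)) : S := match split i with inl _ => 'X_[m] | inr _ => 1 end.
pose dm (i : 'I_1) : int := (mdeg m)%:Z.
pose d0 (i : 'I_1) : int := 0.
pose B (v : 'rV[S]_(1 + 1)) := monid Q (\sum_i v 0 i * c i).
have BE (u v : 'rV[S]_1) :
    B (row_mx u v) <-> monid Q (u 0 0 * 'X_[m] + v 0 0).
  rewrite /B big_split_ord /= !big_ord1 row_mxEl row_mxEr /c.
  by rewrite (unsplitK (inl ord0)) (unsplitK (inr ord0)) mulr1.
have tB : tres L r (dcat dm d0) B.
  apply: (tres_horseshoe (A := fun u => monid (colon Q m) (u 0 0))
                         (C := fun v => monid (adjoin Q m) (v 0 0))).
  - exact: submod_monid.
  - apply: graded_monid => i; rewrite /c /dcat; case: (split i) => a.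
      exact: homzX.
    by rewrite -mpolyC1; apply: homzC.
  - by move=> u; rewrite BE mxE addr0 monidMX.
  - by move=> u v huv; apply/monid_adjoin; exists (u 0 0); apply/(BE u v).
  - move=> v /monid_adjoin [u hu]; exists u%:M; apply/(BE u%:M v).
    by rewrite mxE eqxx mulr1n.
  - apply: eq_tres_deg (leq_tres _ (tres_shift (mdeg m)%:Z (Rc L))) => [i|].
      by rewrite add0r.
    by rewrite subrK.
  - exact: Ra.
apply: eq_tres (tres_cancel_block _ tB) => [v|b].
  by rewrite BE mxE mul0r add0r.
exists (- 'X_[m])%:M; apply/BE; rewrite ord1 !mxE !eqxx mul1r mulr1n subrr.
exact: monid0.
Qed.

(** The syzygies of the generators of [Q] together with [m] are an extension of (Q : m), shifted by
    the degree of [m], by the syzygies of [Q]. Syzygies sit one step further in the resolution,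
    whence [r + 1]. *)
Lemma Rg_adjoin Q m r : upset Q -> Rg Q r -> (mdeg m)%:Z <= r ->
  Rg (colon Q m) (r + 1 - (mdeg m)%:Z) -> Rg (adjoin Q m) r.
Proof.
move=> uQ RQ mr Rc [|L] //=; have [p [dp [D [hD dpr genD tD]]]] := RQ L.+1.
pose dm (i : 'I_1) : int := (mdeg m)%:Z.
pose E : 'M[S]_(1, 1) := 'X_[m]%:M.
have EE (v : 'rV[S]_1) : v *m E = (v 0 0 * 'X_[m])%:M.
  by apply/rowP => i; rewrite ord1 !mxE big_ord1 !mxE !eqxx !mulr1n.
have hDE : homM (dcat dp dm) (fun=> 0) (col_mx D E).
  move=> i j; case: (split_ordP i) => i' ->.
    by rewrite dcatl col_mxEu.
  by rewrite dcatr col_mxEd subr0 !ord1 mxE eqxx mulr1n; apply: homzX.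
exists (p + 1)%N, (dcat dp dm), (col_mx D E); split=> //.
- by move=> i; case: (split_ordP i) => i' ->; rewrite ?dcatl ?dcatr.
- move=> v; rewrite monid_adjoin; split=> [[u hu]|[w ->]].
    have /genD [w hw] : monid Q (((u * 'X_[m])%:M + v) 0 0).
      by rewrite !mxE eqxx mulr1n.
    exists (row_mx w (- u%:M)); rewrite mul_row_col -hw EE.
    apply/rowP => i; rewrite ord1 !mxE !eqxx !mulr1n; ring.
  rewrite -[w]hsubmxK mul_row_col EE; exists (- rsubmx w 0 0).
  rewrite [X in _ + X]mxE [X in _ + (_ + X)]mxE eqxx mulr1n [X in _ + X]addrC.
  by rewrite addrA mulNr addNr add0r; apply/genD; eexists.
apply: (tres_horseshoe (A := ker D) (C := fun v => monid (colon Q m) (v 0 0))).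
- exact: submod_ker.
- exact: graded_ker hDE.
- by move=> u; rewrite /ker mul_row_col mul0mx addr0.
- move=> u v; rewrite /ker mul_row_col EE => h; apply/monidMX.
  have -> : v 0 0 * 'X_[m] = ((- u) *m D) 0 0.
    apply/eqP; rewrite mulNmx mxE -addr_eq0 addrC; apply/eqP.
    by move/rowP/(_ 0): h; rewrite !mxE eqxx mulr1n.
  by apply/(genD (- u *m D)); eexists.
- move=> v /monidMX h.
  have /genD [w hw] : monid Q (((v 0 0 * 'X_[m])%:M : 'rV_1) 0 0).
    by rewrite mxE eqxx mulr1n.
  by exists (- w); rewrite /ker mul_row_col mulNmx -hw EE addNr.
- exact: tD.
apply: eq_tres_deg (leq_tres _ (tres_shift (mdeg m)%:Z (Rc L))) => [i|].
  by rewrite add0r.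
by rewrite subrK.
Qed.

(** The variable is a nonzerodivisor modulo [Q], so the colon ideal is [Q] itself, and degree 1
    offsets the [+ 1] of [Rg_adjoin]. *)
Lemma Rg_add_var Q (i : 'I_n) r : upset Q ->
  (forall m, Q (U_(i) + m)%MM -> Q m) -> 1 <= r -> Rg Q r ->
  Rg (adjoin Q U_(i)%MM) r.
Proof.
move=> uQ hQ r1 RQ; apply: Rg_adjoin => //; rewrite mdeg1 // addrK.
by apply: eq_Rg RQ => m; split=> [Qm|/hQ //]; rewrite /colon addmC; apply: uQ.
Qed.

Definition gens_by (s : seq 'X_{1..n}) : 'X_{1..n} -> Prop :=
  fun m => exists2 g, g \in s & (g <= m)%MM.

Lemma upset_gens_by s : upset (gens_by s).
Proof.
by move=> a b [g gs le]; exists g => //; apply: lepm_trans le (lem_addr _ _).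
Qed.

(** Some bound is needed to know that minimal resolutions exist. Generators are added one by one;
    the colon by [g] is generated by the truncated differences [h - g]. *)
Lemma Rg_exists s : exists r, Rg (gens_by s) r.
Proof.
have [k] := ubnP (size s); elim: k s => // k IH [|g s] sk.
  by exists 0; apply: eq_Rg (Rg_empty 0) => m; split=> // [[]].
have [r1 R1] := IH s sk.
have [|r2 R2] := IH [seq (h - g)%MM | h <- s]; first by rewrite size_map.
pose r := `|r1| + `|r2| + (mdeg g)%:Z; exists r.
apply: (@eq_Rg (adjoin (gens_by s) g)) => [m|].
  split=> [[[h hs le]|le]|[h]].
  - by exists h => //; rewrite inE hs orbT.
  - by exists g => //; rewrite mem_head.
  by rewrite inE => /orP[/eqP ->|hs] le; [right|left; exists h].
apply: Rg_adjoin; first exact: upset_gens_by.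
- apply: leq_Rg R1; rewrite /r; lia.
- rewrite /r; lia.
apply: (@leq_Rg _ r2); first by rewrite /r; lia.
apply: eq_Rg R2 => m; split=> [[h /mapP [h' hs ->] le]|[h hs le]].
  exists h' => //; apply/mnm_lepP => i; move/mnm_lepP/(_ i): le.
  by rewrite mnmBE mnmDE; lia.
exists (h - g)%MM; first by apply: map_f.
apply/mnm_lepP => i; move/mnm_lepP/(_ i): le.
by rewrite mnmBE mnmDE; lia.
Qed.

End MonomialIdeals.

(** * Minimal resolutions and regularity *)

Lemma exists_max_int (P : int -> Prop) (b : int) :
  (exists z, P z) -> (forall z, P z -> z <= b) ->
  exists z, P z /\ forall z', P z' -> z' <= z.
Proof.
move=> [z Pz] Pb; have [k] := ubnP `|b - z|%N; elim: k z Pz => // k IH z Pz zk.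
have [h|] := classic (forall z', P z' -> z' <= z); first by exists z.
move=> h; have [z' hz'] := not_all_ex_not _ _ h.
have [Pz' /negP zz'] := imply_to_and _ _ hz'.
apply: (IH z' Pz'); have := Pb _ Pz; have := Pb _ Pz'; lia.
Qed.

Section Regularity.
Variables (K : fieldType) (n : nat).
Local Notation S := {mpoly K[n]}.
Implicit Types (Q : 'X_{1..n} -> Prop) (r : int).

(** The augmentation counts as map 0, with target S generated in degree 0, so that [fc_map],
    [fc_tdeg] and [fc_im] treat all steps alike. *)
Definition fc_map (F : free_complex K n) i :
    'M[S]_(fc_rank F i, if i is i'.+1 then fc_rank F i' else 1) :=
  match i with 0 => fc_aug F | i'.+1 => fc_diff F i' end.

Definition fc_tdeg (F : free_complex K n) i :
    'I_(if i is i'.+1 then fc_rank F i' else 1) -> int :=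
  match i with 0 => fun=> 0 | i'.+1 => fc_deg (f := F) (i := i') end.

Definition fc_im (I : S -> Prop) (F : free_complex K n) i :
    'rV[S]_(if i is i'.+1 then fc_rank F i' else 1) -> Prop :=
  match i with 0 => fun v => I (v 0 0) | i'.+1 => ker (fc_map F i') end.

Lemma minimal_resolution_step (I : S -> Prop) F i :
  minimal_graded_free_resolution I F ->
  homM (fc_deg (f := F) (i := i)) (@fc_tdeg F i) (fc_map F i) /\
  minimal_gens (@fc_im I F i) (fc_map F i).
Proof.
move=> [[haug hdiff] [r1 r2 r3] hmin].
have kerE j v : ker (fc_map F j) v <-> exists w, v = w *m fc_diff F j.
  by case: j v => [|j] v /=; [apply: r2|apply: r3].
split.
  case: i => [|i] a b /= m.
    by rewrite subr0 ord1; apply: haug.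
  exact: hdiff.
split.
  case: i => [|i] v /=; last exact: kerE.
  rewrite r1; split=> [[w e]|[w ->]]; last by exists w.
  by exists w; apply/rowP => j; rewrite !ord1.
move=> w /kerE [u ->] b; rewrite mxE raddf_sum /= big1 // => c _.
by rewrite rmorphM /= hmin mulr0.
Qed.

(** Climb the minimal resolution with [tres_minimal]; each step consumes one unit of the length
    [L]. *)
Lemma minimal_resolution_bound (I : S -> Prop) F r i :
  minimal_graded_free_resolution I F ->
  (forall L, tres L r (fun _ : 'I_1 => 0) (fun v : 'rV[S]_1 => I (v 0 0))) ->
  forall a : 'I_(fc_rank F i), fc_deg a <= r + i%:Z.
Proof.
move=> hF hI; have step j := minimal_resolution_step j hF.
suff h : forall L, tres L (r + i%:Z) (@fc_tdeg F i) (@fc_im I F i).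
  by have [h1 h2] := step i; case: (tres_minimal h1 h2 (h 1%N)).
elim: i => [|i IH] L; first by rewrite addr0; apply: hI.
have [h1 h2] := step i; have [_] := tres_minimal h1 h2 (IH L.+1).
by rewrite -addrA -PoszD addn1.
Qed.

Lemma minimal_resolution_tres (I : S -> Prop) F r :
  minimal_graded_free_resolution I F ->
  (forall i (a : 'I_(fc_rank F i)), fc_deg a <= r + i%:Z) ->
  forall L, tres L r (fun _ : 'I_1 => 0) (fun v : 'rV[S]_1 => I (v 0 0)).
Proof.
move=> hF hd L; have step j := minimal_resolution_step j hF.
suff h : forall i, tres L (r + i%:Z) (@fc_tdeg F i) (@fc_im I F i).
  by have := h 0%N; rewrite addr0.
elim: L => [|L IH] i //=; have [h1 [h2 _]] := step i.
exists (fc_rank F i), (fc_deg (f := F) (i := i)), (fc_map F i); split=> //.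
by have := IH i.+1; rewrite -addrA -PoszD addn1.
Qed.

(** A [free_complex] consists of functions of [i]. They are obtained by iterating a choice of
    minimal generators on bundled data, since the rank varies from step to step. *)
Record stage := Stage {
  st_rank : nat;
  st_deg : 'I_st_rank -> int;
  st_mod : 'rV[S]_st_rank -> Prop
}.

Record next_gens (s : stage) := NextGens {
  ng_rank : nat;
  ng_deg : 'I_ng_rank -> int;
  ng_mx : 'M[S]_(ng_rank, st_rank s)
}.

Definition choose_gens (s : stage) : next_gens s :=
  epsilon (inhabits (@NextGens s 0 (fun=> 0) 0))
    (fun g => homM (@ng_deg s g) (@st_deg s) (ng_mx g) /\
              minimal_gens (@st_mod s) (ng_mx g)).

Definition next_stage (s : stage) : stage :=
  @Stage (ng_rank (choose_gens s)) (@ng_deg s (choose_gens s))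
         (ker (ng_mx (choose_gens s))).

Lemma choose_gensP (s : stage) q (dq : 'I_q -> int) (D : 'M[S]_(q, st_rank s)) :
  homM dq (@st_deg s) D -> minimal_gens (@st_mod s) D ->
  homM (@ng_deg _ (choose_gens s)) (@st_deg s) (ng_mx (choose_gens s)) /\
  minimal_gens (@st_mod s) (ng_mx (choose_gens s)).
Proof.
move=> hD mD; apply: (epsilon_spec (inhabits (@NextGens s 0 (fun=> 0) 0))
  (fun g => homM (@ng_deg s g) (@st_deg s) (ng_mx g) /\
            minimal_gens (@st_mod s) (ng_mx g))).
by exists (@NextGens s q dq D).
Qed.

Lemma minimal_resolution_exists (I : S -> Prop) r :
  (forall L, tres L r (fun _ : 'I_1 => 0) (fun v : 'rV[S]_1 => I (v 0 0))) ->
  exists F : free_complex K n, minimal_graded_free_resolution I F.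
Proof.
move=> hI; pose s0 := @Stage 1 (fun=> 0) (fun v : 'rV[S]_1 => I (v 0 0)).
pose s i := iter i next_stage s0.
have h0 i : (forall L, tres L (r + i%:Z) (@st_deg (s i)) (@st_mod (s i))) ->
    homM (@ng_deg _ (choose_gens (s i))) (@st_deg (s i))
      (ng_mx (choose_gens (s i))) /\
    minimal_gens (@st_mod (s i)) (ng_mx (choose_gens (s i))).
  move=> hs; have [q [dq [D [hD mD]]]] := minimal_gens_exists (hs 1%N).
  by apply: choose_gensP hD mD.
have h i : homM (@ng_deg _ (choose_gens (s i))) (@st_deg (s i))
      (ng_mx (choose_gens (s i))) /\
    minimal_gens (@st_mod (s i)) (ng_mx (choose_gens (s i))).
  apply: (h0); elim: i => [|i IH] L; first by rewrite addr0; apply: hI.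
  have [h1 h2] := h0 i IH; have [_] := tres_minimal h1 h2 (IH L.+1).
  by rewrite -addrA -PoszD addn1.
exists (@FreeComplex K n (fun i => st_rank (s i.+1)) (fun i => @st_deg (s i.+1))
  (fun i => ng_mx (choose_gens (s i.+1))) (ng_mx (choose_gens s0))); split.
- split=> [a m|i a b m] /=.
    by move=> hm; rewrite -[RHS]subr0; apply: (proj1 (h 0%N) a 0).
  exact: (proj1 (h i.+1) a b).
- split=> [f|v|i v] /=.
  + have := proj1 (proj2 (h 0%N)) f%:M => /= e.
    rewrite mxE eqxx mulr1n in e; rewrite e.
    split=> -[w hw]; exists w; first by rewrite -hw mxE eqxx mulr1n.
    by apply/rowP => j; rewrite ord1 mxE eqxx mulr1n.
  + exact: (proj1 (proj2 (h 1%N)) v).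
  + exact: (proj1 (proj2 (h i.+2)) v).
(* A row of the next matrix is a relation among minimal generators, so it has no constant terms. *)
move=> i a b /=; have [_ [_]] := h i => /(_ (row a (ng_mx (choose_gens (s i.+1))))).
have -> : ker (ng_mx (choose_gens (s i))) = @st_mod (s i.+1) by [].
move=> /(_ _ b); rewrite mxE; apply.
by apply/(proj1 (proj2 (h i.+1))); exists (delta_mx 0 a); rewrite rowE.
Qed.

Lemma is_regularity_exists (I : S -> Prop) r :
  (exists2 f, I f & f != 0) ->
  (forall L, tres L r (fun _ : 'I_1 => 0) (fun v : 'rV[S]_1 => I (v 0 0))) ->
  exists r', is_regularity I r'.
Proof.
move=> [f If f0] hI; have [F hF] := minimal_resolution_exists hI.
pose P z := exists i j, graded_betti F i j != 0%N /\ z = j - i%:Z.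
have bettiP i j : graded_betti F i j != 0%N ->
    exists a : 'I_(fc_rank F i), fc_deg a = j.
  by rewrite -lt0n => /card_gt0P [a]; rewrite inE => /eqP <-; exists a.
have [||r' [Pr' hr']] := @exists_max_int P r.
- have [_ [genI _ _] _] := hF; have [v fv] := proj1 (genI f) If.
  have : exists a : 'I_(fc_rank F 0), True.
    apply: NNPP => na; case/eqP: f0; rewrite fv mxE big1 // => a _.
    by case: na; exists a.
  move=> [a _]; exists (fc_deg a - 0), 0%N, (fc_deg a); split=> //.
  by rewrite -lt0n; apply/card_gt0P; exists a; rewrite inE.
- move=> _ [i [j [/bettiP [a <-] ->]]]; rewrite lerBlDr.
  exact: (minimal_resolution_bound hF hI).
by exists r', F; split=> // i j hb; apply: hr'; exists i, j.
Qed.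

(** [Q m] excludes the convention for the zero ideal, and [Rg] provides a minimal resolution with
    bounded degrees, so [epsilon] picks a genuine regularity. *)
Lemma reg_spec Q (I : S -> Prop) r m :
  (forall f, I f <-> monid Q f) -> Q m -> Rg K Q r -> is_regularity I (reg I).
Proof.
move=> IQ Qm RQ; have h : exists2 f, I f & f != 0.
  exists 'X_[m]; first by apply/IQ/monidX.
  by rewrite -msize_poly_eq0 msizeX.
rewrite /reg; case: excluded_middle_informative => [h'|[]//].
apply: epsilon_spec; apply: (@is_regularity_exists _ r) => // L.
by apply: eq_tres (RQ L) => v; rewrite IQ.
Qed.

Lemma reg_le Q (I : S -> Prop) r m :
  (forall f, I f <-> monid Q f) -> Q m -> Rg K Q r -> reg I <= r.
Proof.
move=> IQ Qm RQ; have [F [hF [i [j [hb ->]]] _]] := reg_spec IQ Qm RQ.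
move: hb; rewrite -lt0n => /card_gt0P [a]; rewrite inE => /eqP <-.
rewrite lerBlDr; apply: (minimal_resolution_bound hF) => L.
by apply: eq_tres (RQ L) => v; rewrite IQ.
Qed.

(** The crude bound [r0] guarantees a minimal resolution, which then realises the bound [r]. *)
Lemma Rg_of_reg Q (I : S -> Prop) r r0 m :
  (forall f, I f <-> monid Q f) -> Q m -> Rg K Q r0 -> reg I <= r -> Rg K Q r.
Proof.
move=> IQ Qm RQ le L; have [F [hF _ hb]] := reg_spec IQ Qm RQ.
apply: (@eq_tres _ _ _ _ _ _ (fun v : 'rV[S]_1 => I (v 0 0))) => [v|].
  by rewrite IQ.
apply: (minimal_resolution_tres hF) => i a.
rewrite -lerBlDr; apply: le_trans le; apply: hb.
by rewrite -lt0n; apply/card_gt0P; exists a; rewrite inE.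
Qed.

End Regularity.

(** * Extension of the set of variables *)

Section VariableExtension.
Variables (K : fieldType) (n k : nat) (h : 'I_k -> 'I_n).
Hypothesis h_inj : injective h.
Local Notation S := {mpoly K[n]}.
Local Notation R := {mpoly K[k]}.
Implicit Types (m : 'X_{1..n}) (a : 'X_{1..k}).

(** Condition (1) concerns polynomial rings on the vertices of subgraphs, whereas walk ideals live
    in all [n] variables. An exponent splits into [mext (mres m)], supported on the image of [h],
    and [mrest m], supported off it. *)
Definition mext a : 'X_{1..n} := (\sum_i U_(h i) *+ a i)%MM.
Definition mres m : 'X_{1..k} := [multinom m (h i) | i < k].
Definition mrest m : 'X_{1..n} := (m - mext (mres m))%MM.

Lemma mextE a i : mext a (h i) = a i.
Proof.
rewrite mnm_sumE (bigD1 i) //= mulmnE mnm1E eqxx mul1n big1 ?addn0 // => j ji.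
by rewrite mulmnE mnm1E (inj_eq h_inj) (negPf ji).
Qed.

Lemma mext_out a j : (forall i, h i != j) -> mext a j = 0%N.
Proof.
move=> hj; rewrite mnm_sumE big1 // => i _.
by rewrite mulmnE mnm1E (negPf (hj i)).
Qed.

Lemma mext_cases (P : 'I_n -> Prop) j :
  (forall i, P (h i)) -> ((forall i, h i != j) -> P j) -> P j.
Proof.
move=> h1 h2; case: (pickP (fun i => h i == j)) => [i /eqP <- //|hj].
by apply: h2 => i; rewrite hj.
Qed.

Lemma mresE m i : mres m i = m (h i). Proof. by rewrite mnmE. Qed.

Lemma mext_mres m : (mext (mres m) <= m)%MM.
Proof.
apply/mnm_lepP => j; apply: (@mext_cases (fun j => (_ <= m j)%N)) => [i|hj].
  by rewrite mextE mresE.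
by rewrite mext_out.
Qed.

Lemma mrestK m : (mrest m + mext (mres m) = m)%MM.
Proof. exact/submK/mext_mres. Qed.

Lemma mres_ext a : mres (mext a) = a.
Proof. by apply/mnmP => i; rewrite mresE mextE. Qed.

Lemma mres_rest m : mres (mrest m) = 0%MM.
Proof. by apply/mnmP => i; rewrite mresE mnmBE mextE mresE subnn mnm0E. Qed.

Lemma mextD a b : mext (a + b)%MM = (mext a + mext b)%MM.
Proof.
apply/mnmP => j; rewrite mnmDE.
apply: (@mext_cases (fun j => mext _ j = (_ j + _ j)%N)) => [i|hj].
  by rewrite !mextE mnmDE.
by rewrite !mext_out.
Qed.

Lemma mresD m m' : mres (m + m')%MM = (mres m + mres m')%MM.
Proof. by apply/mnmP => i; rewrite !(mresE, mnmDE). Qed.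

Lemma mdeg_mext a : mdeg (mext a) = mdeg a.
Proof.
rewrite mdeg_sum mdegE; apply: eq_bigr => i _.
by rewrite mdegMn mdeg1 mul1n.
Qed.

Definition ext_vars : k.-tuple S := [tuple 'X_(h i) | i < k].
Local Notation pext := (comp_mpoly ext_vars).

Lemma pextX a : pext 'X_[a] = 'X_[mext a].
Proof.
rewrite comp_mpolyX -mprodXnE; apply: eq_bigr => i _.
by rewrite tnth_mktuple.
Qed.

Lemma pextE p : pext p = \sum_(a <- msupp p) p@_a *: 'X_[mext a].
Proof.
rewrite {1}[p]mpolyE raddf_sum /=; apply: eq_bigr => a _.
by rewrite linearZ /= pextX.
Qed.

Lemma homz_pext z p : homz z p -> homz z (pext p).
Proof.
move=> hp; rewrite pextE big_seq; elim/big_ind: _ => [|x y|a ap].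
- exact: homz0.
- exact: homzD.
move=> m /msuppZ_le; rewrite msuppX inE => /eqP ->.
by rewrite mdeg_mext; apply: hp.
Qed.

(* The component of [s] along the monomial [rho] in the remaining variables. *)
Definition pcomp (rho : 'X_{1..n}) (s : S) : R :=
  \sum_(m <- msupp s | mrest m == rho) s@_m *: 'X_[mres m].

Lemma mcoeff_pcomp rho s a :
  mres rho = 0%MM -> (pcomp rho s)@_a = s@_(rho + mext a).
Proof.
move=> rho0; rewrite /pcomp (raddf_sum (mcoeff a)) /= big_mkcond /=.
set m0 := (rho + mext a)%MM.
have m0r : mres m0 = a by rewrite mresD rho0 add0m mres_ext.
have m0rho : mrest m0 = rho by rewrite /mrest m0r addmK.
have other m : m != m0 ->
    (if mrest m == rho then (s@_m *: 'X_[mres m] : R)@_a else 0) = 0.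
  move=> nm; case: eqP => // e; rewrite mcoeffZ mcoeffX; case: eqP => [e'|_].
    by case/eqP: nm; rewrite -(mrestK m) e e'.
  by rewrite mulr0.
have [m0s|/memN_msupp_eq0 s0] := boolP (m0 \in msupp s).
  rewrite (bigD1_seq m0) ?msupp_uniq //= m0rho eqxx mcoeffZ mcoeffX m0r eqxx.
  by rewrite mulr1 big1 ?addr0.
rewrite s0 big1 // => m _; have [->|/other //] := eqVneq m m0.
by rewrite s0 scale0r mcoeff0 if_same.
Qed.

Lemma mcoeffMXn (l : nat) (p : {mpoly K[l]}) (a m : 'X_{1..l}) :
  (p * 'X_[a])@_m = if (a <= m)%MM then p@_(m - a) else 0.
Proof.
case: ifP => [le|/negP nle]; first by rewrite -{1}(submK le) addmC mcoeffMX.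
apply: memN_msupp_eq0; apply/negP => /msuppM_le /allpairsP [[x y] /= [_]].
by rewrite msuppX inE => /eqP -> e; apply: nle; rewrite e lem_addl.
Qed.

Lemma pcompMX rho s a : mres rho = 0%MM ->
  pcomp rho (s * 'X_[mext a]) = pcomp rho s * 'X_[a].
Proof.
move=> rho0; apply/mpolyP => b; rewrite mcoeff_pcomp // !mcoeffMXn.
have -> : (mext a <= rho + mext b)%MM = (a <= b)%MM.
  apply/mnm_lepP/mnm_lepP => le i.
    move: (le (h i)); rewrite mnmDE !mextE; suff -> : rho (h i) = 0%N by [].
    by rewrite -mresE rho0 mnm0E.
  apply: (@mext_cases (fun i => (mext a i <= (rho + mext b)%MM i)%N)) => [j|hj].
    by rewrite mnmDE !mextE; apply: leq_trans (le j) (leq_addl _ _).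
  by rewrite mext_out.
case: ifP => // le; rewrite mcoeff_pcomp //; congr mcoeff.
by rewrite -{1}(submK le) mextD addmA addmK.
Qed.

(** S is a free R-module on the monomials in the remaining variables, and taking a component is
    R-linear. *)
Lemma pcompM rho s p : mres rho = 0%MM ->
  pcomp rho (s * pext p) = pcomp rho s * p.
Proof.
move=> rho0.
have pcompD u v : pcomp rho (u + v) = pcomp rho u + pcomp rho v.
  by apply/mpolyP => a; rewrite mcoeffD !mcoeff_pcomp // mcoeffD.
rewrite {2}[p]mpolyE pextE !mulr_sumr.
elim/big_rec2: _ => [|a x y _ IH].
  by apply/mpolyP => a; rewrite mcoeff_pcomp // !mcoeff0.
rewrite pcompD IH; congr (_ + _); rewrite -!scalerAr -pcompMX //.
by apply/mpolyP => b; rewrite mcoeffZ !mcoeff_pcomp // mcoeffZ.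
Qed.

Lemma pcomp_decomp (rs : seq 'X_{1..n}) s :
  uniq rs -> {subset [seq mrest m | m <- msupp s] <= rs} ->
  s = \sum_(rho <- rs) 'X_[rho] * pext (pcomp rho s).
Proof.
move=> urs srs.
transitivity (\sum_(rho <- rs) \sum_(m <- msupp s | mrest m == rho) s@_m *: 'X_[m]).
  rewrite {1}[s]mpolyE (exchange_big_dep xpredT) //=.
  rewrite big_seq [RHS]big_seq; apply: eq_bigr => m ms.
  have mrs : mrest m \in rs by apply/srs/map_f.
  rewrite -big_filter (_ : [seq i <- rs | mrest m == i] = [:: mrest m]).
    by rewrite big_seq1.
  under eq_filter do rewrite eq_sym.
  by rewrite filter_pred1_uniq.
apply: eq_bigr => rho _; rewrite raddf_sum /= mulr_sumr.
apply: eq_bigr => m /eqP <-; rewrite linearZ /= pextX.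
by rewrite -scalerAr -mpolyXD mrestK.
Qed.

(** Extension of scalars from R to S. *)
Definition Next l (N : 'rV[R]_l -> Prop) (v : 'rV[S]_l) :=
  exists t (c : 'I_t -> S) (g : 'I_t -> 'rV[R]_l),
    (forall i, N (g i)) /\ v = \sum_i c i *: map_mx pext (g i).

(** Flatness of S over R: by linearity of [pcomp], the components of a vector in the extended kernel
    lie in the kernel over R. *)
Lemma Next_ker p l (D : 'M[R]_(p, l)) v :
  Next (ker D) v <-> ker (map_mx pext D) v.
Proof.
split=> [[t [c [g [hg ->]]]]|hv].
  rewrite /ker mulmx_suml big1 // => i _.
  by rewrite -scalemxAl -map_mxM hg map_mx0 scaler0.
pose rs := undup [seq mrest m | m <- flatten [seq msupp (v 0 j) | j <- enum 'I_p]].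
exists (size rs), (fun i => 'X_[nth 0%MM rs i]),
  (fun i => \row_j pcomp (nth 0%MM rs i) (v 0 j)); split=> [i|].
  have /mapP [m _ rhoE] : nth 0%MM rs i \in
      [seq mrest m | m <- flatten [seq msupp (v 0 j) | j <- enum 'I_p]].
    by rewrite -mem_undup mem_nth.
  rewrite rhoE; apply/rowP => j; move/rowP/(_ j): hv; rewrite !mxE => hv.
  have := congr1 (pcomp (mrest m)) hv.
  have pcompD u w : pcomp (mrest m) (u + w) = pcomp (mrest m) u + pcomp (mrest m) w.
    by apply/mpolyP => a; rewrite mcoeffD !mcoeff_pcomp ?mres_rest // mcoeffD.
  have pcomp0 : pcomp (mrest m) 0 = 0.
    by apply/mpolyP => a; rewrite mcoeff_pcomp ?mres_rest // !mcoeff0.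
  rewrite (big_morph _ pcompD pcomp0) pcomp0 => {2}<-.
  by apply: eq_bigr => i' _; rewrite !mxE pcompM ?mres_rest.
apply/rowP => j; rewrite summxE (pcomp_decomp (rs := rs) (s := v 0 j)).
- rewrite (big_nth 0%MM) big_mkord; apply: eq_bigr => i _.
  by rewrite !mxE.
- exact: undup_uniq.
move=> _ /mapP [m ms ->]; rewrite mem_undup; apply: map_f.
by apply/flattenP; exists (msupp (v 0 j)) => //; apply: map_f; rewrite mem_enum.
Qed.

Lemma tres_ext L r l (dl : 'I_l -> int) N :
  tres L r dl N -> tres L r dl (Next N).
Proof.
elim: L r l dl N => [|L IH] //= r l dl N [p [dp [D [hD dpr genD tD]]]].
exists p, dp, (map_mx pext D); split=> //.
- by move=> i j; rewrite mxE; apply: homz_pext.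
- move=> v; split=> [[t [c [g [hg ->]]]]|[w ->]].
    have /fin_all_exists [w hw] : forall i, exists w, g i = w *m D.
      by move=> i; apply/genD.
    exists (\sum_i c i *: map_mx pext (w i)).
    rewrite mulmx_suml; apply: eq_bigr => i _.
    by rewrite -scalemxAl hw map_mxM.
  exists p, (fun i => w 0 i), (fun i => row i D); split=> [i|].
    by apply/genD; exists (delta_mx 0 i); rewrite rowE.
  by rewrite mulmx_sum_row; apply: eq_bigr => i _; rewrite map_row.
by apply: eq_tres (IH _ _ _ _ tD) => v; apply: Next_ker.
Qed.

Lemma Rg_ext Q r : upset Q -> Rg K Q r -> Rg K (fun m => Q (mres m)) r.
Proof.
move=> uQ RQ L; apply: eq_tres (tres_ext (RQ L)) => v.
split=> [[t [c [g [hg ->]]]]|hv].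
  rewrite summxE; apply: monid_sum => i _; rewrite !mxE; apply: monidM.
    by move=> m m'; rewrite mresD; apply: uQ.
  rewrite pextE big_seq; apply: monid_sum => a ag; apply: monidZ.
  by apply/monidX; rewrite mres_ext; apply: (hg i a ag).
pose s := msupp (v 0 0).
exists (size s), (fun i => (v 0 0)@_(nth 0%MM s i) *: 'X_[mrest (nth 0%MM s i)]).
exists (fun i => ('X_[mres (nth 0%MM s i)])%:M); split=> [i|].
  by rewrite mxE eqxx mulr1n; apply/monidX/hv; rewrite mem_nth.
apply/rowP => j; rewrite ord1 summxE {1}[v 0 0]mpolyE (big_nth 0%MM) big_mkord.
apply: eq_bigr => i _; rewrite !mxE eqxx mulr1n pextX -scalerAl -mpolyXD.
by rewrite mrestK.
Qed.

End VariableExtension.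

(** * Edge ideals and their powers as monomial ideals *)

Section EdgeIdeals.
Variables (K : fieldType) (n : nat).
Local Notation S := {mpoly K[n]}.

Lemma ideal_gen_monid (A : S -> Prop) Q :
  upset Q -> (forall f, A f -> monid Q f) ->
  (forall m, Q m -> exists2 g, A 'X_[g] & (g <= m)%MM) ->
  forall f, ideal_gen A f <-> monid Q f.
Proof.
move=> uQ AQ QA f; split=> [[t [c [g [hg ->]]]]|hf].
  by apply: monid_sum => i _; apply: monidM => //; apply: AQ.
rewrite [f]mpolyE big_seq; elim/big_ind: _ => [|x y [t [c [g [hg ->]]]]|m mf].
- by exists 0%N, (fun=> 0), (fun=> 0); split=> [[]//|]; rewrite big_ord0.
- move=> [t' [c' [g' [hg' ->]]]]; exists (t + t')%N.
  exists (fun i => match split i with inl j => c j | inr j => c' j end).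
  exists (fun i => match split i with inl j => g j | inr j => g' j end).
  split=> [i|]; first by case: (split i) => j.
  rewrite big_split_ord /=; congr (_ + _); apply: eq_bigr => i _.
    by rewrite (unsplitK (inl i)).
  by rewrite (unsplitK (inr i)).
have [g Ag le] := QA _ (hf _ mf).
exists 1%N, (fun=> f@_m *: 'X_[m - g]), (fun=> 'X_[g]); split=> //.
by rewrite big_ord1 -scalerAl -mpolyXD submK.
Qed.

Definition edge_mon (e : rel 'I_n) (m : 'X_{1..n}) :=
  exists i j, e i j /\ m = (U_(i) + U_(j))%MM.

Definition edge_up e m := exists2 g, edge_mon e g & (g <= m)%MM.

(** Exponents add, so this is the product of the monomials in the list. *)
Definition tot (l : seq 'X_{1..n}) : 'X_{1..n} := (\sum_(g <- l) g)%MM.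

Definition pow_up e q m := exists l, [/\ size l = q,
  forall g, g \in l -> edge_mon e g & (tot l <= m)%MM].

Lemma upset_edge_up e : upset (edge_up e).
Proof.
by move=> a b [g gs le]; exists g => //; apply: lepm_trans le (lem_addr _ _).
Qed.

Lemma upset_pow_up e q : upset (pow_up e q).
Proof.
move=> a b [l [sl el le]]; exists l; split=> //.
exact: lepm_trans le (lem_addr _ _).
Qed.

Lemma edge_ideal_monid e f : edge_ideal K e f <-> monid (edge_up e) f.
Proof.
apply: ideal_gen_monid; first exact: upset_edge_up.
  move=> _ [i [j [eij ->]]]; rewrite -mpolyXD; apply/monidX.
  by exists (U_(i) + U_(j))%MM; [exists i, j|exact: lepm_refl].
move=> m [_ [i [j [eij ->]]] le]; exists (U_(i) + U_(j))%MM => //.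
by exists i, j; rewrite mpolyXD.
Qed.

Lemma ideal_pow_monid e q f :
  ideal_pow (edge_ideal K e) q f <-> monid (pow_up e q) f.
Proof.
apply: ideal_gen_monid; first exact: upset_pow_up.
  move=> _ [g [hg ->]]; elim: q g hg => [|q IH] g hg.
    rewrite big_ord0 -mpolyX0; apply/monidX; exists [::]; split=> //.
    by rewrite /tot big_nil lepm_refl.
  rewrite big_ord_recl => m /msuppM_le /allpairsP [[a b] /= [ha hb ->]].
  have [c ec ca] := proj1 (edge_ideal_monid e (g ord0)) (hg ord0) _ ha.
  have [l [sl el le]] := IH (fun i => g (lift ord0 i)) (fun i => hg _) _ hb.
  exists (c :: l); split=> [/=|x|]; first by rewrite sl.
    by rewrite inE => /orP[/eqP ->|/el].
  rewrite /tot big_cons; apply/mnm_lepP => i; rewrite !mnmDE.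
  by apply: leq_add; apply/mnm_lepP.
move=> m [l [sl el le]]; exists (tot l) => //.
exists (fun i : 'I_q => 'X_[nth 0%MM l i]); split=> [i|].
  apply/edge_ideal_monid/monidX; exists (nth 0%MM l i); last exact: lepm_refl.
  by apply/el/mem_nth; rewrite sl.
by rewrite mprodXE /tot (big_nth 0%MM) big_mkord sl.
Qed.

End EdgeIdeals.

(** * Alternating walks *)

Section Walks.
Variable n : nat.
Implicit Types (A : rel 'I_n) (l M : seq 'X_{1..n}) (u v w x y a b : 'I_n).

Definition ed u v : 'X_{1..n} := (U_(u) + U_(v))%MM.

Lemma edC u v : ed u v = ed v u. Proof. exact: addmC. Qed.

Lemma edE u v i : ed u v i = ((u == i) + (v == i))%N.
Proof. by rewrite mnmDE !mnm1E. Qed.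

Lemma ed_inj u v a b : ed u v = ed a b -> (u = a /\ v = b) \/ (u = b /\ v = a).
Proof.
move=> e; have := congr1 (fun m : 'X_{1..n} => m u) e.
rewrite /= !edE eqxx; have [ea _|_] := eqVneq a u.
  left; subst a; split=> //; apply/eqP; rewrite -eq_mnm1; apply/eqP.
  exact: addmI e.
have [eb _|_ //] := eqVneq b u; right; subst b; split=> //.
apply/eqP; rewrite -eq_mnm1; apply/eqP; apply: (@addmI _ U_(u)%MM).
by rewrite -/(ed u v) e edC.
Qed.

Lemma le_ed u v m : u != v -> (ed u v <= m)%MM = (m u != 0%N) && (m v != 0%N).
Proof.
move=> uv; apply/mnm_lepP/andP => [le|[mu mv] i].
  split; [have := le u|have := le v]; rewrite edE eqxx; last first.
    by rewrite addn1; case: (m v).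
  by case: (m u).
rewrite edE; have [<-|_] := eqVneq u i; last by case: eqP => // <-; rewrite lt0n.
by rewrite eq_sym (negPf uv) lt0n.
Qed.

(* [ec A l u v]: an alternating walk from [u] to [v] whose edges of odd index
   are taken from [A] and whose edges of even index form the list [l]. *)
Inductive ec A : seq 'X_{1..n} -> 'I_n -> 'I_n -> Prop :=
| ec_edge u v : A u v -> ec A [::] u v
| ec_step u w w' v l : A u w -> ec A l w' v -> ec A (ed w w' :: l) u v.

Lemma ec_cat A l1 l2 u a b v :
  ec A l1 u a -> ec A l2 b v -> ec A (l1 ++ ed a b :: l2) u v.
Proof.
elim=> [u' a' ua|u' w w' a' l uw _ IH] h; first exact: ec_step ua h.
by apply: ec_step uw _; apply: IH.
Qed.

Lemma ec_sym A l u v : ssrbool.symmetric A -> ec A l u v -> ec A (rev l) v u.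
Proof.
move=> sA; elim=> [u' v' uv|u' w w' v' l' uw _ IH].
  by apply: ec_edge; rewrite sA.
rewrite rev_cons -cats1 edC; apply: ec_cat IH _.
by apply: ec_edge; rewrite sA.
Qed.

(** A walk trades its even edges and its two ends for its odd edges, which are one more in
    number. *)
Lemma ec_tot A l u v : ec A l u v ->
  exists l', [/\ size l' = (size l).+1, forall g, g \in l' -> edge_mon A g &
    tot l' = (tot l + ed u v)%MM].
Proof.
elim=> [u' v' uv|u' w w' v' l' uw _ [s [ss es ts]]].
  exists [:: ed u' v']; split=> // [g|].
    by rewrite inE => /eqP ->; exists u', v'.
  by rewrite /tot big_seq1 big_nil add0m.
exists (ed u' w :: s); split=> [|g|]; first by rewrite /= ss.
  by rewrite inE => /orP[/eqP ->|/es //]; exists u', w.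
rewrite /tot !big_cons -!/(tot _) ts; apply/mnmP => i.
by rewrite !mnmDE !mnm1E; lia.
Qed.

Lemma ec_split A l u v a b : ec A l u v -> ed a b \in l ->
  exists l1 l2, perm_eq l (l1 ++ ed a b :: l2) /\
    ((ec A l1 u a /\ ec A l2 b v) \/ (ec A l1 u b /\ ec A l2 a v)).
Proof.
elim=> [//|u' w w' v' l' uw hl IH]; rewrite inE.
have [e _|_ /= /IH [l1 [l2 [p hl12]]]] := eqVneq (ed a b) (ed w w').
  exists [::], l'; rewrite /= e; split=> //.
  by case: (ed_inj e) => -[-> ->]; [left|right]; split=> //; apply: ec_edge.
exists (ed w w' :: l1), l2; split; first by rewrite /= perm_cons.
by case: hl12 => -[h1 h2]; [left|right]; split=> //; apply: ec_step h1.
Qed.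

(** These are all the vertices of the walk: an interior vertex is an end of an even edge. *)
Definition on_walk l u v y := [\/ y = u, y = v | exists p, ed y p \in l].

(** A walk begins and ends with odd edges, so each of its vertices lies on one. *)
Lemma ec_nbr A l u v y : ssrbool.symmetric A -> ec A l u v -> on_walk l u v y ->
  exists2 y', A y y' & on_walk l u v y'.
Proof.
move=> sA; elim=> [u' v' uv|u' w w' v' l' uw hl IH].
  case=> [->|->|[p //]]; first by exists v' => //; constructor 2.
  by exists u'; rewrite 1?sA //; constructor 1.
have lift y' : on_walk l' w' v' y' -> on_walk (ed w w' :: l') u' v' y'.
  case=> [->|->|[p hp]]; last by constructor 3; exists p; rewrite inE hp orbT.
    by constructor 3; exists w; rewrite edC mem_head.
  by constructor 2.
have IH' : on_walk l' w' v' y ->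
    exists2 y', A y y' & on_walk (ed w w' :: l') u' v' y'.
  by move=> /IH [y' yy' /lift]; exists y'.
case=> [->|e|[p]]; first by exists w => //; constructor 3; exists w'; rewrite mem_head.
  by apply: IH'; constructor 2.
rewrite inE => /orP[/eqP/ed_inj|hp]; last by apply: IH'; constructor 3; exists p.
case=> -[e _]; last by apply: IH'; constructor 1.
rewrite e.
by exists u'; rewrite 1?sA //; constructor 1.
Qed.

Lemma ec_restrict A A' (P : 'I_n -> Prop) l u v :
  (forall i j, A i j -> P i -> P j -> A' i j) ->
  (forall y, on_walk l u v y -> P y) -> ec A l u v -> ec A' l u v.
Proof.
move=> AA' hP h; elim: h hP => [u' v' uv|u' w w' v' l' uw _ IH] hP.
  by apply/ec_edge/AA' => //; apply: hP; [constructor 1|constructor 2].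
apply: ec_step.
  apply: AA' uw _ _; apply: hP; first by constructor 1.
  by constructor 3; exists w'; rewrite mem_head.
apply: IH => y; case=> [->|->|[p hp]]; apply: hP.
- by constructor 3; exists w; rewrite edC mem_head.
- by constructor 2.
by constructor 3; exists p; rewrite inE hp orbT.
Qed.

Lemma eq_ec A A' l u v : A =2 A' -> ec A l u v -> ec A' l u v.
Proof. by move=> e; apply: (@ec_restrict _ _ (fun=> True)) => // i j; rewrite e. Qed.

(** Lists serve as multisets: a walk may use an even edge as often as it occurs in [M]. *)
Definition msub l M := forall g, (count_mem g l <= count_mem g M)%N.

Definition conn A M u v := exists2 l, msub l M & ec A l u v.

Lemma conn_sym A M u v : ssrbool.symmetric A -> conn A M u v -> conn A M v u.
Proof.
move=> sA [l lM h]; exists (rev l); last exact: ec_sym.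
by move=> g; rewrite count_rev.
Qed.

(* Take a shortest walk from [v] to a vertex [y] of the walk [l]. It shares no
   matching edge with [l], so it can be continued along [l] to one of its ends. *)
Lemma conn_avoid A M v l u w y p : ssrbool.symmetric A ->
  msub l M -> ec A l u w -> ~ conn A M v u -> ~ conn A M v w ->
  conn A M v y -> ed y p \notin l.
Proof.
move=> sA lM hl nu nw [lQ lQM hQ].
have [k] := ubnP (size lQ); elim: k lQ y p lQM hQ => // k IH lQ y p lQM hQ sk.
apply/negP => ypl; have [h|] := classic (msub (lQ ++ l) M).
  have [l1 [l2 [pl hl12]]] := ec_split hl ypl.
  case: hl12 => -[h1 h2].
    apply: nw; exists (lQ ++ ed y p :: l2); last exact: ec_cat hQ h2.
    move=> g; apply: leq_trans (h g); rewrite !count_cat (permP pl).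
    by rewrite count_cat /=; lia.
  apply: nu; exists (lQ ++ ed y p :: rev l1).
    move=> g; apply: leq_trans (h g); rewrite !count_cat (permP pl).
    by rewrite count_cat /= count_rev; lia.
  by apply: ec_cat hQ _; apply: ec_sym.
move=> nh; have [g ng] := not_all_ex_not _ _ nh; move/negP: ng.
rewrite -ltnNge count_cat => lt.
have gl : g \in l by rewrite -has_pred1 has_count; have := lQM g; lia.
have gQ : g \in lQ by rewrite -has_pred1 has_count; have := lM g; lia.
have [a [b eg]] : exists a b, g = ed a b.
  elim: {+}hl gl => [//|u' w1 w2 v' l' _ _ IHl]; rewrite inE => /orP[/eqP ->|//].
  by exists w1, w2.
subst g; have [l1 [l2 [pQ hQ12]]] := ec_split hQ gQ.
have sl : (size l1 < k)%N.
  by move: sk; rewrite (perm_size pQ) size_cat /=; lia.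
have l1M : msub l1 M.
  by move=> g; apply: leq_trans (lQM g); rewrite (permP pQ) count_cat leq_addr.
case: hQ12 => -[h1 _].
  by have := IH l1 a b l1M h1 sl; rewrite gl.
by have := IH l1 b a l1M h1 sl; rewrite edC gl.
Qed.

(** The two ends of a walk may coincide, so squares of variables can be among the generators. *)
Definition Tq A M (Z : 'I_n -> Prop) : 'X_{1..n} -> Prop := fun m =>
  (exists2 z, Z z & (U_(z) <= m)%MM) \/
  (exists u v, conn A M u v /\ (ed u v <= m)%MM).

Lemma upset_Tq A M Z : upset (Tq A M Z).
Proof.
move=> m m' [[z Zz le]|[u [v [c le]]]]; [left; exists z|right; exists u, v] => //.
  exact: lepm_trans le (lem_addr _ _).
split=> //; exact: lepm_trans le (lem_addr _ _).
Qed.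

End Walks.

(** * Walk ideals *)

Definition dec (P : Prop) : bool :=
  if excluded_middle_informative P then true else false.

Lemma decP (P : Prop) : reflect P (dec P).
Proof. by rewrite /dec; case: excluded_middle_informative => h; constructor. Qed.

Section InducedSubgraphs.
Variables (K : fieldType) (n : nat) (e : rel 'I_n).
Hypothesis e_sym : ssrbool.symmetric e.
Implicit Types (W U : {set 'I_n}) (M : seq 'X_{1..n}) (Z : 'I_n -> Prop).

Definition adjW W : rel 'I_n := [rel i j | [&& e i j, i \in W & j \in W]].

Lemma adjW_sym W : ssrbool.symmetric (adjW W).
Proof. by move=> i j; rewrite /adjW /= e_sym; case: (i \in W); rewrite ?andbF ?andbT. Qed.

Definition okM W M := forall g, g \in M -> edge_mon (adjW W) g.

(** A walk ending at [v] has its other end in [D]. A walk with neither end in [D] avoids [D] by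
    [conn_avoid], hence also avoids [x], whose neighbours lie in [D]; it therefore survives in [W1]
    with its even edges in [M1]. *)
Lemma colon_Tq W M Z v x :
  ~ Z v -> (forall c, adjW W x c -> conn (adjW W) M v c) ->
  let D := conn (adjW W) M v in
  let W1 := [set y in W | ~~ dec (D y) & y != x] in
  let M1 := [seq g : 'X_{1..n} <- M | [forall i, (g i != 0%N) ==> (i \in W1)]] in
  forall m, colon (Tq (adjW W) M Z) U_(v)%MM m <->
            Tq (adjW W1) M1 (fun z => Z z \/ D z) m.
Proof.
move=> nZv xD D W1 M1 m; split; last first.
  case=> [[z [Zz|[l lM hl]] le]|[u [w [[l lM hl] le]]]].
  - by left; exists z => //; apply: lepm_trans le (lem_addl _ _).
  - right; exists v, z; split; first by exists l.
    by apply/mnm_lepP => i; rewrite !mnmDE leq_add2l; apply/mnm_lepP.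
  right; exists u, w; split; last exact: lepm_trans le (lem_addl _ _).
  exists l.
    move=> g; apply: leq_trans (lM g) _; rewrite count_filter.
    by apply: sub_count => h /andP[].
  apply: (ec_restrict (P := fun=> True)) hl => // i j /and3P[ij iW jW] _ _.
  by move: iW jW; rewrite /adjW /= ij !inE => /andP[-> _] /andP[-> _].
case=> [[z Zz le]|[u [w [[l lM hl] le]]]].
  left; exists z; first by left.
  move: le; rewrite !lep1mP mnmDE mnm1E.
  by case: (v =P z) => [vz|//]; case: nZv; rewrite vz.
have Dcase y y' : conn (adjW W) M y y' -> (ed y y' <= U_(v) + m)%MM -> y = v ->
    Tq (adjW W1) M1 (fun z => Z z \/ D z) m.
  move=> c lev yv; subst y; left; exists y'; first by right.
  apply/mnm_lepP => i; move/mnm_lepP/(_ i): lev.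
  by rewrite !mnmDE leq_add2l.
have cuw : conn (adjW W) M u w by exists l.
have [uv|/eqP uv] := eqVneq u v; first exact: (Dcase u w cuw le uv).
have [wv|/eqP wv] := eqVneq w v.
  by apply: (Dcase w u _ _ wv); [apply: conn_sym cuw; apply: adjW_sym|rewrite edC].
(* Neither end is [v], so the factor [v] does not help divisibility. *)
have lem : (ed u w <= m)%MM.
  apply/mnm_lepP => i; move/mnm_lepP/(_ i): le; rewrite mnmDE mnm1E edE.
  by case: (v =P i) => // <-; rewrite !(introF eqP).
have [Du|nDu] := classic (D u).
  left; exists u; first by right.
  exact: lepm_trans (lem_addr _ _) lem.
have [Dw|nDw] := classic (D w).
  left; exists w; first by right.
  exact: lepm_trans (lem_addl _ _) lem.
have avoid y : on_walk l u w y -> ~ D y.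
  case=> [-> //|-> //|[p ypl]] Dy.
  by have := conn_avoid p (@adjW_sym W) lM hl nDu nDw Dy; rewrite ypl.
have onW1 y : on_walk l u w y -> y \in W1.
  move=> hy; have [y' yy' hy'] := ec_nbr (@adjW_sym W) hl hy.
  have /and3P[_ yW _] := yy'.
  rewrite inE yW /=; apply/andP; split; first by apply/decP/avoid.
  apply/eqP => yx; subst y.
  exact: (avoid _ hy' (xD _ yy')).
right; exists u, w; split=> //; exists l; last first.
  apply: (ec_restrict (P := fun y => y \in W1)) hl => // i j /and3P[ij _ _] iW jW.
  by rewrite /adjW /= ij iW jW.
move=> g; case: (boolP (g \in l)) => [gl|/count_memPn -> //].
(* All ends of [g] lie on the walk, hence in [W1], so the filter keeps every copy of [g]. *)
rewrite count_filter; apply: leq_trans (lM g) _.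
rewrite leq_eqVlt; apply/orP; left; apply/eqP/eq_count => h /=.
case: (h =P g) => // ->; symmetry; apply/forallP => i; apply/implyP => gi.
apply: onW1; constructor 3.
elim: {+}hl gl => [//|u' w1 w2 v' l' _ _ IHl]; rewrite inE => /orP[/eqP gE|/IHl [p hp]].
  move: gi; rewrite gE edE; case: (w1 =P i) => [<- _|_].
    by exists w2; rewrite mem_head.
  by case: (w2 =P i) => [<- _|//]; exists w1; rewrite edC mem_head.
by exists p; rewrite inE hp orbT.
Qed.

(** Iterated [Rg_colon_adjoin] over the variables in [vs]. The colon bound is asked for all [Z']
    because the set of adjoined variables grows. *)
Lemma Rg_Tq_vars A M r (vs : seq 'I_n) Z :
  (forall v Z', v \in vs -> ~ Z' v ->
     Rg K (colon (Tq A M Z') U_(v)%MM) (r - 1)) ->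
  Rg K (Tq A M (fun z => Z z \/ z \in vs)) r -> Rg K (Tq A M Z) r.
Proof.
elim: vs Z => [|v vs IH] Z hvs.
  apply: eq_Rg => m; split=> [[[z [Zz|//] le]|hm]|[[z Zz le]|hm]]; try by right.
    by left; exists z.
  by left; exists z => //; left.
have IH' Z' : Rg K (Tq A M (fun z => Z' z \/ z \in vs)) r -> Rg K (Tq A M Z') r.
  by apply: IH => w Z'' wvs; apply: hvs; rewrite inE wvs orbT.
move=> h; have [Zv|nZv] := classic (Z v).
  apply: IH'; apply: eq_Rg h => m.
  split=> [[[z [Zz|]]|hm]|[[z [Zz|zvs]]|hm]]; try by right.
  - by move=> le; left; exists z => //; left.
  - rewrite inE => /orP[/eqP ->|zvs] le; left; first by exists v => //; left.
    by exists z => //; right.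
  - by move=> le; left; exists z => //; left.
  - by move=> le; left; exists z => //; right; rewrite inE zvs orbT.
apply: (Rg_colon_adjoin (m := U_(v)%MM)); first exact: upset_Tq.
  by rewrite mdeg1; apply: hvs => //; rewrite mem_head.
apply: (@eq_Rg _ _ (Tq A M (fun z => Z z \/ z = v))) => [m|].
  split=> [[[z [Zz|->]]|hm]|[[[z Zz le]|hm]|le]].
  - by move=> le; left; left; exists z.
  - by move=> le; right.
  - by left; right.
  - by left; exists z => //; left.
  - by right.
  - by left; exists v => //; right.
apply: IH'; apply: eq_Rg h => m.
split=> [[[z [Zz|]]|hm]|[[z [[Zz|->]|zvs]]|hm]]; try by right.
- by move=> le; left; exists z => //; left; left.
- rewrite inE => /orP[/eqP ->|zvs] le; left; first by exists v => //; left; right.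
  by exists z => //; right.
- by move=> le; left; exists z => //; left.
- by move=> le; left; exists v => //; right; rewrite mem_head.
- by move=> le; left; exists z => //; right; rewrite inE zvs orbT.
Qed.

Lemma Rg_add_vars Q (vs : seq 'I_n) r : upset Q -> 1 <= r ->
  (forall i m, i \in vs -> Q (U_(i) + m)%MM -> Q m) -> Rg K Q r ->
  Rg K (fun m => Q m \/ exists2 i, i \in vs & (U_(i) <= m)%MM) r.
Proof.
move=> uQ r1; elim: vs => [|v vs IH] hQ RQ.
  by apply: eq_Rg RQ => m; split=> [Qm|[//|[i //]]]; left.
have {}IH : Rg K (fun m => Q m \/ exists2 i, i \in vs & (U_(i) <= m)%MM) r.
  by apply: IH RQ => i m ivs; apply: hQ; rewrite inE ivs orbT.
have uQ' : upset (fun m => Q m \/ exists2 i, i \in vs & (U_(i) <= m)%MM).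
  move=> a b [Qa|[i ivs le]]; [by left; apply: uQ|right; exists i => //].
  exact: lepm_trans le (lem_addr _ _).
have [vvs|nvs] := boolP (v \in vs).
  apply: eq_Rg IH => m; split=> -[Qm|[i ivs le]]; try by left.
    by right; exists i => //; rewrite inE ivs orbT.
  by right; exists i => //; move: ivs; rewrite inE => /orP[/eqP ->|].
apply: eq_Rg (Rg_add_var (i := v) uQ' _ r1 IH) => [m|m].
  split=> [[[Qm|[i ivs le]]|le]|[Qm|[i]]].
  - by left.
  - by right; exists i => //; rewrite inE ivs orbT.
  - by right; exists v => //; rewrite mem_head.
  - by left; left.
  by rewrite inE => /orP[/eqP ->|ivs] le; [right|left; right; exists i].
case=> [Qm|[i ivs le]]; first by left; apply: hQ Qm; rewrite mem_head.
right; exists i => //; move: le; rewrite !lep1mP mnmDE mnm1E.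
by case: (v =P i) => [vi|//]; rewrite vi ivs in nvs.
Qed.

Lemma edge_up_Rg_exists (k : nat) (A : rel 'I_k) : exists r, Rg K (edge_up A) r.
Proof.
have [r R] := Rg_exists K [seq ed p.1 p.2 | p <- enum {: 'I_k * 'I_k} & A p.1 p.2].
exists r; apply: eq_Rg R => m; split=> [[g /mapP [[i j]]]|[g [i [j [ij ->]]] le]].
  rewrite mem_filter /= => /andP[ij _] -> le.
  by exists (ed i j) => //; exists i, j.
exists (ed i j) => //; apply/mapP; exists (i, j) => //.
by rewrite mem_filter /= ij mem_enum.
Qed.

(** Carries condition (1) from the ring on [U] to the ring in all variables by [Rg_ext]. *)
Lemma Rg_induced U r : has_edge e U ->
  reg (edge_ideal K (induced e U)) <= r -> Rg K (edge_up (adjW U)) r.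
Proof.
case/exists_inP => x xU /exists_inP [y yU exy] le.
have [r0 R0] := edge_up_Rg_exists (induced e U).
have e0 : edge_up (induced e U) (ed (enum_rank_in xU x) (enum_rank_in xU y)).
  exists (ed (enum_rank_in xU x) (enum_rank_in xU y)); last exact: lepm_refl.
  by do 2!eexists; split=> //; rewrite /induced !enum_rankK_in.
have R := Rg_of_reg (edge_ideal_monid (induced e U)) e0 R0 le.
have R' := Rg_ext (@enum_val_inj _ (mem U)) (@upset_edge_up _ _) R.
apply: eq_Rg R' => m; split.
  case=> _ [i [j [eij ->]]] /mnm_lepP le'.
  exists (ed (enum_val i) (enum_val j)).
    by exists (enum_val i), (enum_val j); rewrite /adjW /= !enum_valP /= andbT.
  apply/mnm_lepP => k; rewrite edE.
  case: (pickP (fun a : 'I_#|U| => enum_val a == k)) => [a /eqP <-|hk].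
    by have := le' a; rewrite edE mresE !(inj_eq enum_val_inj).
  by rewrite !hk.
case=> _ [i [j [/and3P[eij iU jU] ->]]] /mnm_lepP le'.
exists (ed (enum_rank_in iU i) (enum_rank_in iU j)).
  by do 2!eexists; split=> //; rewrite /induced !enum_rankK_in.
apply/mnm_lepP => a; rewrite edE mresE; have := le' (enum_val a).
have er k : k \in U -> (enum_rank_in iU k == a) = (k == enum_val a).
  move=> kU; apply/eqP/eqP => [<-|->]; first by rewrite enum_rankK_in.
  by rewrite enum_valK_in.
by rewrite !er // mnmDE !mnm1E.
Qed.

(** * Regularity of walk ideals bounded by rho *)

Variable rho : {set 'I_n} -> nat.
Hypothesis rho_edgeless : forall U, ~~ has_edge e U -> rho U = 0%N.
Hypothesis rho_reg : forall U, has_edge e U ->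
  reg (edge_ideal K (induced e U)) <= (rho U)%:Z + 1.
Hypothesis rho_mono : forall U U1, has_edge e U -> U1 \subset U ->
  (rho U1 <= rho U)%N.
Hypothesis rho_vertex : forall U, has_edge e U ->
  exists2 x : 'I_n, x \in U & (rho (U :\: closed_nbhd e U x) + 1 <= rho U)%N.

Lemma Rg_edge_up U : Rg K (edge_up (adjW U)) ((rho U)%:Z + 1).
Proof.
have [h|nh] := boolP (has_edge e U); first exact: Rg_induced (rho_reg h).
apply: eq_Rg (Rg_empty _ _ _) => m; split=> // -[_ [i [j [/and3P[eij iU jU] _]]] _].
by case/negP: nh; apply/exists_inP; exists i => //; apply/exists_inP; exists j.
Qed.

Lemma rho_sub U U1 : U1 \subset U -> (rho U1 <= rho U)%N.
Proof.
move=> s; have [h|nh] := boolP (has_edge e U); first exact: rho_mono.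
rewrite [rho U1]rho_edgeless //; apply: contra nh.
case/exists_inP => x xU /exists_inP [y yU exy].
apply/exists_inP; exists x; first exact: (subsetP s).
by apply/exists_inP; exists y => //; apply: (subsetP s).
Qed.

(** With [M] empty, walks are single edges. Edges meeting [Z] are redundant, and the variables of
    [Z] are nonzerodivisors modulo the edge ideal of the rest. *)
Lemma Rg_Tq_nil W Z : Rg K (Tq (adjW W) [::] Z) ((rho W)%:Z + 1).
Proof.
pose U := [set y in W | ~~ dec (Z y)].
have RU : Rg K (edge_up (adjW U)) ((rho W)%:Z + 1).
  apply: leq_Rg (Rg_edge_up U); rewrite lerD2r lez_nat; apply: rho_sub.
  by apply/subsetP => y; rewrite inE => /andP[].
have zs_dec z : (z \in [seq z <- enum 'I_n | dec (Z z)]) = dec (Z z).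
  by rewrite mem_filter mem_enum andbT.
have r1 : 1 <= (rho W)%:Z + 1 by lia.
apply: eq_Rg (Rg_add_vars (vs := [seq z <- enum 'I_n | dec (Z z)])
  (@upset_edge_up _ _) r1 _ RU) => [m|z m].
  split=> [[[_ [i [j [/and3P[eij iU jU] ->]]] le]|[z]]|].
  - right; exists i, j; split=> //; exists [::] => //; constructor.
    by move: iU jU; rewrite !inE /adjW /= eij => /andP[-> _] /andP[-> _].
  - by rewrite zs_dec => /decP Zz le; left; exists z.
  case=> [[z Zz le]|[u [w [[l l0 hl] le]]]].
    by right; exists z => //; rewrite zs_dec; apply/decP.
  have l0' : l = [::].
    by case: l l0 {hl} => // g l /(_ g) /=; rewrite eqxx.
  subst l; inversion hl as [u' w' uw E1 E2 E3|]; subst.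
  have [Zu|nZu] := classic (Z u).
    right; exists u; first by rewrite zs_dec; apply/decP.
    exact: lepm_trans (lem_addr _ _) le.
  have [Zw|nZw] := classic (Z w).
    right; exists w; first by rewrite zs_dec; apply/decP.
    exact: lepm_trans (lem_addl _ _) le.
  left; exists (ed u w) => //; exists u, w; split=> //.
  case/and3P: uw => euw uW wW; rewrite /adjW /= euw !inE uW wW /=.
  by apply/andP; split; apply/decP.
rewrite zs_dec => /decP Zz [_ [i [j [/and3P[eij iU jU] ->]]] le].
exists (ed i j); first by exists i, j; rewrite /adjW /= eij iU jU.
have nz k : k \in U -> (k == z) = false.
  by rewrite inE => /andP[_ /decP nZ]; apply/eqP => kz; apply: nZ; rewrite kz.
apply/mnm_lepP => k; move/mnm_lepP/(_ k): le; rewrite [X in (_ <= X)%N]mnmDE mnm1E.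
by case: (eqVneq z k) => // <- _; rewrite edE !nz.
Qed.

(** Outer induction on the size of [W], for colon ideals and vertex deletion; inner induction on the
    size of [M], for removal of an edge of [M]. *)
Lemma Rg_Tq W M Z : okM W M -> Rg K (Tq (adjW W) M Z) ((rho W)%:Z + 1).
Proof.
have [k] := ubnP #|W|; elim: k W M Z => // k IHW W M Z sW.
have [l] := ubnP (size M); elim: l M Z => // l IHM M Z sM okW.
have [M0|] := posnP (size M); first by rewrite (size0nil M0); apply: Rg_Tq_nil.
move=> M_gt0; have g0M : nth 0%MM M 0 \in M by apply: mem_nth.
have hW : has_edge e W.
  have [i [j [/and3P[eij iW jW] _]]] := okW _ g0M.
  by apply/exists_inP; exists i => //; apply/exists_inP; exists j.
have [x xW rx] := rho_vertex hW.
(* The new vertex set [W1] lies in [W] minus N[x], so [rho W1 + 1 <= rho W]; this pays for the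
   degree of [v]. *)
have good v Z' : ~ Z' v -> (forall c, adjW W x c -> conn (adjW W) M v c) ->
    Rg K (colon (Tq (adjW W) M Z') U_(v)%MM) ((rho W)%:Z + 1 - 1).
  move=> nZv xD; have := colon_Tq nZv xD; cbv zeta.
  set D := conn (adjW W) M v; set W1 := [set _ in _ | _ & _].
  set M1 := filter _ _ => E.
  apply: (@eq_Rg _ _ (Tq (adjW W1) M1 (fun z => Z' z \/ D z))) => [m|].
    by split=> /E.
  apply: (@leq_Rg _ _ _ ((rho W1)%:Z + 1)).
    rewrite addrK -PoszD lez_nat; apply: leq_trans rx; rewrite leq_add2r.
    apply: rho_sub; apply/subsetP => y; rewrite !inE => /and3P[yW /decP nDy yx].
    rewrite yW (negPf yx) andbT /=; apply/negP => exy; apply: nDy; apply: xD.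
    by rewrite /adjW /= exy xW yW.
  apply: IHW.
    apply: leq_trans (_ : (#|W1| < #|W|)%N) _; last by rewrite -ltnS.
    apply: proper_card; apply/properP; split.
      by apply/subsetP => y; rewrite inE => /and3P[].
    by exists x => //; rewrite inE eqxx !andbF.
  move=> g; rewrite mem_filter => /andP[/forallP gW1 /okW [i [j [/and3P[eij _ _] gE]]]].
  exists i, j; split=> //; rewrite /adjW /= eij /=.
  apply/andP; split; [move: (gW1 i)|move: (gW1 j)].
    by rewrite gE mnmDE !mnm1E eqxx.
  by rewrite gE mnmDE !mnm1E eqxx addn1.
have [/existsP [b xbM]|nxM] := boolP [exists b, ed x b \in M].
  pose M' := rem (ed x b) M.
  have cM g : count_mem g M = (count_mem g M' + (ed x b == g))%N.
    by rewrite (permP (perm_to_rem xbM)) /= addnC.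
  have exb : adjW W x b.
    have [i [j [ij /ed_inj]]] := okW _ xbM.
    by case=> -[-> ->] //; rewrite adjW_sym.
  (* A walk from b to v through [M'] extends backwards by the edge xb of [M] and an edge xc, joining
     v to every neighbour c of x. *)
  apply: (@Rg_Tq_vars _ _ _ [seq v <- enum 'I_n | dec (conn (adjW W) M' b v)]).
    move=> v Z'; rewrite mem_filter => /andP[/decP [lb lbM hb] _] nZ'v.
    apply: good => // c xc; apply: conn_sym; first exact: adjW_sym.
    exists (ed x b :: lb); last by apply: ec_step hb; rewrite adjW_sym.
    by move=> g; rewrite /= cM addnC leq_add2r.
  set Z1 := fun z => _ \/ _.
  (* A walk using xb more often than [M'] allows splits there, and one of its ends is then joined to
     b through [M']; its variable is already adjoined. *)
  apply: (@eq_Rg _ _ (Tq (adjW W) M' Z1)) => [m|]; last first.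
    apply: IHM; first by rewrite size_rem //; move: sM; rewrite -(ltn_predK M_gt0).
    by move=> g /mem_rem; apply: okW.
  have inZ1 z : conn (adjW W) M' b z -> Z1 z.
    by move=> c; right; rewrite mem_filter mem_enum andbT; apply/decP.
  split=> [[h|[u [w [[p pM hp] le]]]]|[h|[u [w [[p pM hp] le]]]]]; try by left.
    right; exists u, w; split=> //; exists p => // g.
    by rewrite cM; apply: leq_trans (pM g) (leq_addr _ _).
  have [xbp|/count_memPn nxb] := boolP (ed x b \in p); last first.
    right; exists u, w; split=> //; exists p => // g.
    by have := pM g; rewrite cM; case: (_ =P g) => [<-|_]; rewrite ?nxb ?addn0.
  left; have [p1 [p2 [pp hp12]]] := ec_split hp xbp.
  have p2M : msub p2 M'.
    by move=> g; have := pM g; rewrite cM (permP pp) count_cat /=; lia.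
  have p1M : msub p1 M'.
    by move=> g; have := pM g; rewrite cM (permP pp) count_cat /=; lia.
  case: hp12 => -[h1 h2].
    exists w; last exact: lepm_trans (lem_addl _ _) le.
    by apply: inZ1; exists p2.
  exists u; last exact: lepm_trans (lem_addr _ _) le.
  by apply/inZ1/conn_sym; [apply: adjW_sym|exists p1].
have xM b : ed x b \notin M.
  by move: nxM; rewrite negb_exists => /forallP.
(* No edge of [M] contains [x], so [x] can only be an end of a walk, and those products are
   multiples of the adjoined variable [x]. *)
have del Z' : Z' x -> Rg K (Tq (adjW W) M Z') ((rho W)%:Z + 1).
  move=> Zx; apply: (@eq_Rg _ _ (Tq (adjW (W :\ x)) M Z')) => [m|].
    split=> [[h|[u [w [[p pM hp] le]]]]|[h|[u [w [[p pM hp] le]]]]]; try by left.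
      right; exists u, w; split=> //; exists p => //.
      apply: (ec_restrict (P := fun=> True)) hp => // i j /and3P[ij iW jW] _ _.
      by move: iW jW; rewrite /adjW /= ij !inE => /andP[_ ->] /andP[_ ->].
    have [ux|/eqP ux] := eqVneq u x.
      by left; exists x => //; apply: lepm_trans le; rewrite -ux lem_addr.
    have [wx|/eqP wx] := eqVneq w x.
      by left; exists x => //; apply: lepm_trans le; rewrite -wx lem_addl.
    right; exists u, w; split=> //; exists p => //.
    apply: (ec_restrict (P := fun y => y <> x)) hp => [i j /and3P[ij iW jW] ix jx|y].
      by rewrite /adjW /= !inE ij iW jW !andbT /=; apply/andP; split; apply/eqP.
    case=> [->|->|[b ybp]] // yx; subst y.
    case/negP: (xM b); rewrite -has_pred1 has_count; apply: leq_trans (pM _).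
    by rewrite -has_count has_pred1.
  apply: (@leq_Rg _ _ _ ((rho (W :\ x))%:Z + 1)).
    by rewrite lerD2r lez_nat; apply: rho_sub; apply: subD1set.
  apply: IHW.
    by move: sW; rewrite (cardsD1 x) xW add1n ltnS.
  move=> g gM; have [i [j [/and3P[eij iW jW] gE]]] := okW _ gM.
  exists i, j; split=> //; rewrite /adjW /= eij !inE iW jW !andbT /=.
  apply/andP; split; apply/eqP => hx; subst.
    by move: (xM j); rewrite gM.
  by move: (xM i); rewrite edC gM.
have [Zx|nZx] := classic (Z x); first exact: del.
(* Colon by [x] itself: its neighbours are joined to it by single edges. *)
apply: (@Rg_Tq_vars _ _ _ [:: x]).
  move=> v Z'; rewrite inE => /eqP -> nZ'; apply: good => // c xc.
  by exists [::] => //; constructor.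
by apply: del; right; rewrite mem_head.
Qed.

End InducedSubgraphs.

(** * Exchange along alternating walks *)

(** Coordinatewise estimate for [exchange]: removing both halves of a trail from an excess to a
    deficit vertex does not enlarge the excess. *)
Lemma leq_sub_shift (b l a m s t : nat) : (b + s = l + t -> s <= 1 ->
  (s = 1 -> b + a < l + m) -> a - m <= (b + a) - (l + m))%N.
Proof. lia. Qed.

(** Coordinatewise estimate for [trail]: prolonging a walk by zy and yx moves the excess from x back
    to z. *)
Lemma leq_step_shift (x v a m s y : nat) : (x + v <= a - m -> s <= 1 ->
  (s = 1 -> x = 0%N /\ m <= a) -> s + v <= (s + y + a) - (y + x + m))%N.
Proof. lia. Qed.

Section Exchange.
Variables (n : nat) (e : rel 'I_n).
Hypothesis e_sym : ssrbool.symmetric e.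
Hypothesis e_irr : irreflexive e.
Implicit Types (A B M l : seq 'X_{1..n}) (x y z u v : 'I_n).

Definition edges l := forall g, g \in l -> edge_mon e g.

Lemma tot_cat l1 l2 : tot (l1 ++ l2) = (tot l1 + tot l2)%MM.
Proof. exact: big_cat. Qed.

Lemma tot_cons g l : tot (g :: l) = (g + tot l)%MM.
Proof. exact: big_cons. Qed.

Lemma perm_tot l1 l2 : perm_eq l1 l2 -> tot l1 = tot l2.
Proof. exact: perm_big. Qed.

Lemma mdeg_tot l : edges l -> mdeg (tot l) = (size l).*2.
Proof.
elim: l => [|g l IH] el; first by rewrite /tot big_nil mdeg0.
rewrite tot_cons mdegD IH => [|h hl]; last by apply: el; rewrite inE hl orbT.
have [i [j [_ ->]]] := el g (mem_head _ _).
by rewrite mdegD !mdeg1 doubleS.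
Qed.

Lemma tot_gt0 l z : edges l -> (0 < tot l z)%N ->
  exists y l', e z y /\ perm_eq l (ed z y :: l').
Proof.
elim: l => [|g l IH] el; first by rewrite /tot big_nil mnm0E.
have [i [j [eij gE]]] := el g (mem_head _ _).
rewrite tot_cons mnmDE addn_gt0 gE -/(ed i j) edE.
case: (eqVneq i z) => [<- _|_]; first by exists j, l; split=> //; rewrite gE.
case: (eqVneq j z) => [<- _|_].
  by exists i, l; rewrite e_sym edC; split=> //; rewrite gE.
move=> /= /IH [h hl|y [l' [ezy p]]]; first by apply: el; rewrite inE hl orbT.
exists y, (ed i j :: l'); split=> //.
apply: (@perm_trans _ (ed i j :: ed z y :: l')); first by rewrite perm_cons.
by apply/permP => q; rewrite /= addnCA.
Qed.

Lemma edges_perm l l1 l2 : perm_eq l (l1 ++ l2) -> edges l ->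
  edges l1 /\ edges l2.
Proof.
move=> p el; split=> g gl; apply: el; rewrite (perm_mem p) mem_cat gl ?orbT //.
Qed.

(** From a vertex with more [A]-edges than [M]-edges, follow edges of [A] and [M] alternately. The
    trail stops at another excess after an edge of [A], giving a walk, or at a deficit after an edge
    of [M], giving lists of equal size whose products differ by exchanging y and z. *)
Lemma trail A M z : edges A -> edges M -> (tot M z < tot A z)%N ->
  exists B A' l M', [/\ perm_eq A (B ++ A'), perm_eq M (l ++ M') &
    (exists v, ec e l z v /\ (ed z v <= tot A - tot M)%MM) \/
    (exists y, [/\ (tot A y < tot M y)%N, size B = size l &
       (tot B + U_(y) = tot l + U_(z))%MM])].
Proof.
have [k] := ubnP (size A); elim: k A M z => // k IH A M z sA eA eM exz.
have [|y [A0 [ezy pA]]] := tot_gt0 (z := z) eA; first exact: leq_ltn_trans exz.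
have zy : z != y by apply: contraTneq ezy => ->; rewrite e_irr.
have [yex|ydef] := ltnP (tot M y) (tot A y).
  exists [::], A, [::], M; split=> //; left; exists y; split.
    exact: ec_edge.
  by rewrite le_ed // !mnmBE !subn_eq0 -!ltnNge exz.
have tAE : tot A = (ed z y + tot A0)%MM by rewrite (perm_tot pA) tot_cons.
(* [y] is not in excess although [A] has an edge there, so [M] has one too. *)
have y_gt0 : (0 < tot M y)%N.
  by apply: leq_trans ydef; rewrite tAE mnmDE edE eqxx; case: eqP.
have [x [M0 [eyx pM]]] := tot_gt0 eM y_gt0.
have xy : x != y by apply: contraTneq eyx => ->; rewrite e_irr.
have tME : tot M = (ed y x + tot M0)%MM by rewrite (perm_tot pM) tot_cons.
have tA i : tot A i = ((z == i) + (y == i) + tot A0 i)%N.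
  by rewrite tAE mnmDE edE.
have tM i : tot M i = ((y == i) + (x == i) + tot M0 i)%N.
  by rewrite tME mnmDE edE.
have [_ eA0] := edges_perm (l1 := [:: _]) pA eA.
have [_ eM0] := edges_perm (l1 := [:: _]) pM eM.
have sA0 : (size A0 < k)%N by move: sA; rewrite (perm_size pA).
have [xdef|xex] := ltnP (tot A x) (tot M x).
  exists [:: ed z y], A0, [:: ed y x], M0; split=> //; right; exists x.
  split=> //; apply/mnmP => i; rewrite /tot !big_seq1 !mnmDE !mnm1E; clear; lia.
(* If the trail returns at once, the same edge lies in [A] and in [M]; set both copies aside and
   restart at [z]. *)
have [xz|xz] := eqVneq x z.
  subst x; have [|B [A' [l [M' [pA0 pM0 h]]]]] := IH A0 M0 z sA0 eA0 eM0.
    by have := exz; rewrite tA tM; clear; lia.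
  exists B, (ed z y :: A'), l, (ed y z :: M'); split.
  - by rewrite (perm_trans pA) // perm_sym perm_catC /= perm_cons perm_catC perm_sym.
  - by rewrite (perm_trans pM) // perm_sym perm_catC /= perm_cons perm_catC perm_sym.
  case: h => [[v [hv le]]|[y' [dy' sz te]]]; [left; exists v|right; exists y'].
    split=> //; apply: lepm_trans le _; apply/mnm_lepP => i.
    by rewrite !mnmBE tA tM; clear; lia.
  by split=> //; rewrite tA tM; move: dy'; clear; lia.
(* This rules out [z] as final deficit vertex, so a deficit for [A0] and [M0] is one for [A] and
   [M]. *)
have M0z : (tot M0 z <= tot A0 z)%N.
  by have := exz; rewrite tA tM eqxx (negPf xz); clear; lia.
have [|B [A' [l [M' [pA0 pM0 h]]]]] := IH A0 M0 x sA0 eA0 eM0.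
  have := xex; rewrite tA tM eqxx [z == x]eq_sym [y == x]eq_sym.
  by rewrite (negPf xz) (negPf xy); clear; lia.
exists (ed z y :: B), A', (ed y x :: l), M'; split.
- by rewrite (perm_trans pA) // perm_cons.
- by rewrite (perm_trans pM) // perm_cons.
case: h => [[v [hv /mnm_lepP le]]|[y' [dy' sz te]]]; [left; exists v|right; exists y'].
  split; first exact: ec_step ezy hv.
  apply/mnm_lepP => i; have := le i; rewrite !mnmBE !edE tA tM => lei.
  apply: leq_step_shift lei (leq_b1 _) _.
  by case: (z =P i) => // <- _; rewrite (negPf xz).
split; last first.
- apply/mnmP => i; move/mnmP/(_ i): te.
  by rewrite !tot_cons !mnmDE !mnm1E; clear; lia.
- by rewrite /= sz.
rewrite tA tM; have [zy'|_] := eqVneq z y'.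
  by subst y'; rewrite ltnNge M0z in dy'.
by move: dy'; clear; lia.
Qed.

Variables (N : nat) (wgt : 'X_{1..n} -> 'X_{1..N}).

Definition weight l : 'X_{1..N} := (\sum_(g <- l) wgt g)%MM.

Lemma weight_cat l1 l2 : weight (l1 ++ l2) = (weight l1 + weight l2)%MM.
Proof. exact: big_cat. Qed.

Lemma perm_weight l1 l2 : perm_eq l1 l2 -> weight l1 = weight l2.
Proof. exact: perm_big. Qed.

(** Peel off a trail [B], [l]. If [B] is heavier than [l], swapping it into [M] gives the second
    outcome; otherwise removing both preserves the hypotheses. Without excess vertices the two
    products agree, and [A] itself is the heavier list of the third outcome. *)
Lemma exchange A M : edges A -> edges M -> (size M <= size A)%N ->
  (size A = size M -> (weight M < weight A)%O) ->
  [\/ exists u v, conn e M u v /\ (ed u v <= tot A - tot M)%MM,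
      exists z y M', [/\ edges M', size M' = size M, (weight M < weight M')%O,
        (tot M' + U_(y) = tot M + U_(z))%MM & (U_(z) <= tot A - tot M)%MM]
    | exists M', [/\ edges M', size M' = size M, (weight M < weight M')%O &
        tot M' = tot M]].
Proof.
have [k] := ubnP (size A); elim: k A M => // k IH A M sA eA eM sMA wMA.
have [/existsP hz|nex] := boolP [exists z, (tot M z < tot A z)%N]; last first.
  have le z : (tot A z <= tot M z)%N.
    by move: nex; rewrite negb_exists => /forallP/(_ z); rewrite -leqNgt.
  (* Every coordinate of [tot A] is at most that of [tot M], while the total degree is at least as
     large. *)
  have eqAM : tot A = tot M.
    have eqd : (\sum_i tot M i <= \sum_i tot A i)%N.
      by rewrite -!mdegE !mdeg_tot // leq_double.
    apply/mnmP => z; apply/eqP; rewrite eqn_leq le /=.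
    move: eqd; rewrite (bigD1 z) //= [X in (_ <= X)%N](bigD1 z) //=.
    have h : (\sum_(i | i != z) tot A i <= \sum_(i | i != z) tot M i)%N.
      by apply: leq_sum => i _.
    move=> h'; rewrite -(leq_add2r (\sum_(i | i != z) tot A i)%N).
    by apply: leq_trans h'; rewrite leq_add2l.
  have sAM : size A = size M.
    by apply: double_inj; rewrite -!mdeg_tot // eqAM.
  by constructor 3; exists A; split=> //; apply: wMA.
have {hz} [z exz] : exists z : 'I_n, (tot M z < tot A z)%N := hz.
have [B [A1 [l [M1 [pA pM h]]]]] := trail eA eM exz.
case: h => [[v [hv le]]|[y [ydef sz te]]].
  constructor 1; exists z, v; split=> //; exists l => // g.
  by rewrite (permP pM) count_cat leq_addr.
have [eB eA1] := edges_perm pA eA; have [el eM1] := edges_perm pM eM.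
have wA : weight A = (weight B + weight A1)%MM by rewrite (perm_weight pA) weight_cat.
have wM : weight M = (weight l + weight M1)%MM by rewrite (perm_weight pM) weight_cat.
have tA i : tot A i = (tot B i + tot A1 i)%N by rewrite (perm_tot pA) tot_cat mnmDE.
have tM i : tot M i = (tot l i + tot M1 i)%N by rewrite (perm_tot pM) tot_cat mnmDE.
have tBl i : (tot B i + (y == i) = tot l i + (z == i))%N.
  by move/mnmP/(_ i): te; rewrite !mnmDE !mnm1E.
have sAE : size A = (size B + size A1)%N by rewrite (perm_size pA) size_cat.
have sME : size M = (size l + size M1)%N by rewrite (perm_size pM) size_cat.
have [wlB|wBl] := ltP (weight l) (weight B).
  constructor 2; exists z, y, (B ++ M1); split.
  - by move=> g; rewrite mem_cat => /orP[/eB|/eM1].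
  - by rewrite size_cat sz sME.
  - by rewrite wM weight_cat ltmc_add2l.
  - by apply/mnmP => i; rewrite tot_cat !mnmDE !mnm1E tM addnAC tBl addnAC.
  - by rewrite lep1mP mnmBE subn_eq0 -ltnNge.
have exc i : (tot A1 i - tot M1 i <= (tot B i + tot A1 i) - (tot l i + tot M1 i))%N.
  apply: leq_sub_shift (tBl i) (leq_b1 _) _.
  by case: eqP => // <- _; rewrite -tA -tM.
have zy : z != y.
  by apply: contraTneq exz => ->; rewrite -leqNgt ltnW.
(* An empty trail would force [y = z]; so the induction on the size of [A] decreases. *)
have B_gt0 : (0 < size B)%N.
  rewrite lt0n; apply/negP => /eqP/size0nil B0; move: (tBl y).
  have l0 : l = [::] by apply: size0nil; rewrite -sz B0.
  by rewrite B0 l0 eqxx (negPf zy) addn0 addn1 => /eqP; rewrite eqn_leq ltnn.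
have [|||[u [v [[p pM1 hp] le]]]|[z' [y' [M' [eM' sM' wM' tM' le]]]]
  |[M' [eM' sM' wM' tM']]] := IH A1 M1 _ eA1 eM1.
- by move: sA B_gt0; rewrite sAE; clear; lia.
- by move: sMA; rewrite sAE sME sz leq_add2l.
- move=> sAM1; have := wMA (etrans sAE (etrans (congr2 addn sz sAM1) (esym sME))).
  rewrite wA wM => lt; rewrite ltNge; apply/negP => le.
  by move: lt; rewrite ltNge lem_add.
- constructor 1; exists u, v; split.
    exists p => // g; apply: leq_trans (pM1 g) _.
    by rewrite (permP pM) count_cat leq_addl.
  apply: lepm_trans le _; apply/mnm_lepP => i; rewrite !mnmBE tA tM.
  exact: exc.
- constructor 2; exists z', y', (l ++ M'); split.
  + by move=> g; rewrite mem_cat => /orP[/el|/eM'].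
  + by rewrite size_cat sM' sME.
  + by rewrite wM weight_cat ltmc_add2r.
  + apply/mnmP => i; move/mnmP/(_ i): tM'.
    by rewrite tot_cat !mnmDE tM -!addnA => ->.
  apply: lepm_trans le _; apply/mnm_lepP => i; rewrite !mnmBE tA tM.
  exact: exc.
constructor 3; exists (l ++ M'); split.
- by move=> g; rewrite mem_cat => /orP[/el|/eM'].
- by rewrite size_cat sM' sME.
- by rewrite wM weight_cat ltmc_add2r.
by apply/mnmP => i; rewrite tot_cat !mnmDE tM tM'.
Qed.

End Exchange.

(** * Powers of edge ideals *)

Section MultisetWeight.
Variables (n : nat) (e : rel 'I_n).
Local Notation I2 := ('I_n * 'I_n)%type.

Definition pmon (p : I2) : 'X_{1..n} := ed p.1 p.2.

(* The weight of a list of edges is its multiplicity vector, so that weights are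
   totally ordered compatibly with concatenation and determine the product. *)
Definition edge_wgt (g : 'X_{1..n}) : 'X_{1..#|{: I2}|} :=
  if [pick p : I2 | g == pmon p] is Some p then U_(enum_rank p)%MM else 0%MM.

Definition unweight (m : 'X_{1..#|{: I2}|}) : 'X_{1..n} :=
  (\sum_k (pmon (enum_val k)) *+ m k)%MM.

Lemma unweightD a b : unweight (a + b)%MM = (unweight a + unweight b)%MM.
Proof.
rewrite /unweight -big_split /=; apply: eq_bigr => k _.
by apply/mnmP => i; rewrite !mnmDE !mulmnE mulnDr.
Qed.

Lemma unweight0 : unweight 0%MM = 0%MM.
Proof. by rewrite /unweight big1 // => k _; rewrite mnm0E mulm0n. Qed.

Lemma unweight_edge g : edge_mon e g -> unweight (edge_wgt g) = g.
Proof.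
move=> [i [j [_ gE]]]; rewrite /edge_wgt; case: pickP => [p /eqP ->|/(_ (i, j))].
  rewrite /unweight (bigD1 (enum_rank p)) //= mnm1E eqxx mulm1n enum_rankK.
  rewrite big1 ?addm0 // => k /negPf nk.
  by rewrite mnm1E eq_sym nk mulm0n.
by rewrite gE /pmon /= eqxx.
Qed.

Lemma unweight_weight l : edges e l -> unweight (weight edge_wgt l) = tot l.
Proof.
elim: l => [_|g l IH el]; first by rewrite /weight /tot !big_nil unweight0.
rewrite /weight big_cons unweightD tot_cons -/(weight _ _) IH.
  by rewrite unweight_edge //; apply: el; rewrite mem_head.
by move=> h hl; apply: el; rewrite inE hl orbT.
Qed.

(** Tuples of pairs form a finite type, which allows finite sets and maximal elements. *)
Lemma edges_lift q l : edges e l -> size l = q ->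
  exists2 t : q.-tuple I2, all (fun p => e p.1 p.2) t & map pmon t = l.
Proof.
move=> el <-; elim: l el => [_|g l IH el]; first by exists [tuple].
have [h hl|t vt tE] := IH; first by apply: el; rewrite inE hl orbT.
have [i [j [eij gE]]] := el g (mem_head _ _).
by exists [tuple of (i, j) :: t]; rewrite /= ?eij // tE gE.
Qed.

Lemma edges_tuple q (t : q.-tuple I2) :
  all (fun p => e p.1 p.2) t -> edges e (map pmon t).
Proof. by move=> /allP vt _ /mapP [p /vt ep ->]; exists p.1, p.2. Qed.

End MultisetWeight.

(** * Passage from I^q to I^(q+1) *)

Section Powers.
Variables (K : fieldType) (n : nat) (e : rel 'I_n).
Hypothesis e_sym : ssrbool.symmetric e.
Hypothesis e_irr : irreflexive e.
Variables (q : nat) (r s : int).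
Hypothesis Rg_Tq_s : forall M Z, edges e M -> size M = q -> Rg K (Tq e M Z) s.
Hypothesis sr : s + 2 * q%:Z <= r.
Hypothesis Rg_q : Rg K (pow_up e q) r.

Local Notation T := (q.-tuple ('I_n * 'I_n)).
Local Notation wt t := (weight (@edge_wgt n) (map (@pmon n) t)).
Local Notation valid t := (all (fun p => e p.1 p.2) t).
Local Notation mon t := (tot (map (@pmon n) t)).

Definition partial_pow (A : {set T}) (m : 'X_{1..n}) : Prop :=
  pow_up e q.+1 m \/ exists2 t : T, t \in A & (mon t <= m)%MM.

Lemma upset_partial_pow A : upset (partial_pow A).
Proof.
move=> a b [Qa|[t tA le]]; [by left; apply: upset_pow_up|right; exists t => //].
exact: lepm_trans le (lem_addr _ _).
Qed.

(** Strict comparison suffices, since tuples of equal weight have the same product. *)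
Definition upclosed (A : {set T}) :=
  (forall t, t \in A -> valid t) /\
  (forall t t' : T, t \in A -> valid t' -> (wt t < wt t')%O -> t' \in A).

(** Replacing the even edges of a walk by its odd ones turns M times the two ends into a product of
    q+1 edges. Conversely, [exchange] applied to a generator dividing [mon t] times [m] yields a
    walk or a variable. *)
Lemma colon_partial_pow A (t : T) : upclosed A -> valid t -> t \notin A ->
  (forall t' : T, valid t' -> (wt t < wt t')%O -> t' \in A) ->
  ~ partial_pow A (mon t) ->
  forall m, colon (partial_pow A) (mon t) m <->
    Tq e (map (@pmon n) t) (fun z => partial_pow A (mon t + U_(z))%MM) m.
Proof.
move=> [vA cA] vt ntA tmax nt m; set M := map _ t.
have eM : edges e M by apply: edges_tuple.
have sM : size M = q by rewrite size_map size_tuple.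
have inA M' : edges e M' -> size M' = q ->
    (weight (@edge_wgt n) M < weight (@edge_wgt n) M')%O ->
    exists2 t' : T, t' \in A & tot M' = mon t'.
  move=> eM' sM' lt; have [t' vt' t'E] := edges_lift eM' sM'.
  by exists t'; [apply: tmax; rewrite ?t'E|rewrite t'E].
split; last first.
  case=> [[z hz /submK le]|[u [v [[l lM hl] le]]]].
    rewrite /colon -le [(m - _ + _)%MM]addmC addmA.
    exact: upset_partial_pow.
  have [l' [sl' el' tl']] := ec_tot hl.
  have /count_subseqP [l1 /perm_to_subseq [M1 pM1] pl1] :
    forall g, (count_mem g l <= count_mem g M)%N by [].
  have pM : perm_eq M (l ++ M1).
    by rewrite (perm_trans pM1) // perm_cat2r perm_sym.
  have [_ eM1] := edges_perm pM eM.
  left; exists (l' ++ M1); split.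
  - by rewrite size_cat sl' addSn -size_cat -(perm_size pM) sM.
  - by move=> g; rewrite mem_cat => /orP[/el'|/eM1].
  apply/mnm_lepP => i; move/mnm_lepP/(_ i): le.
  by rewrite tot_cat tl' (perm_tot pM) tot_cat !mnmDE; lia.
have main A' : edges e A' -> (q <= size A')%N ->
    (size A' = q -> (weight (@edge_wgt n) M < weight (@edge_wgt n) A')%O) ->
    (tot A' <= tot M + m)%MM ->
    Tq e M (fun z => partial_pow A (mon t + U_(z))%MM) m.
  move=> eA' sA' wA' /mnm_lepP le.
  have sub g : (g <= tot A' - tot M)%MM -> (g <= m)%MM.
    move=> h; apply: lepm_trans h _; apply/mnm_lepP => i.
    by have := le i; rewrite mnmBE mnmDE leq_subLR.
  have [||[u [v [c h]]]|[z [y [M' [eM' sM' wM' tM' h]]]]|[M' [eM' sM' wM' tM']]] :=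
      exchange e_sym e_irr (wgt := @edge_wgt n) eA' eM.
  - by rewrite sM.
  - by rewrite sM.
  - by right; exists u, v; split=> //; apply: sub.
  - left; exists z; last exact: sub.
    have [t' t'A t'E] := inA M' eM' (etrans sM' sM) wM'.
    right; exists t' => //; rewrite -t'E -/M -tM'; exact: lem_addr.
  (* The third outcome of [exchange] would put [mon t] in the ideal already. *)
  case: nt; have [t' t'A t'E] := inA M' eM' (etrans sM' sM) wM'.
  by right; exists t' => //; rewrite -t'E tM' lepm_refl.
case=> [[A' [sA' eA' le]]|[t' t'A le]].
  by apply: (main A') => //; rewrite sA' // => /eqP; rewrite eqn_leq ltnn.
have vt' := vA _ t'A; have et' := edges_tuple vt'.
apply: (main (map (@pmon n) t')) => //; rewrite size_map size_tuple // => _.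
(* Equal weights would put [mon t] in the ideal, and a lighter member of [A] would put [t] in
   [A]. *)
rewrite ltNge le_eqVlt; apply/negP => /orP[/eqP w|w].
  case: nt; right; exists t' => //.
  by rewrite -!(unweight_weight (e := e)) // w lepm_refl.
by case/negP: ntA; apply: cA w.
Qed.

(** Induction on the complement of [A]. Once [A] contains all q-tuples of edges, the ideal is I^q;
    before that, adjoin a heaviest missing tuple. *)
Lemma Rg_partial_pow A : upclosed A -> Rg K (partial_pow A) r.
Proof.
have [k] := ubnP #|~: A|; elim: k A => // k IH A sA [vA cA].
have [/existsP [t0 /andP[vt0 t0A]]|nex] :=
  boolP [exists t : T, valid t && (t \notin A)]; last first.
  apply: eq_Rg Rg_q => m; split=> [[l [sl el le]]|[[l [sl el le]]|[t tA le]]].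
  - have [t vt tE] := edges_lift el sl; right; exists t; last by rewrite tE.
    move: nex; rewrite negb_exists => /forallP/(_ t).
    by rewrite vt /= negbK.
  - case: l sl el le => [//|g l] [sl] el le.
    exists l; split=> // [h hl|]; first by apply: el; rewrite inE hl orbT.
    by apply: lepm_trans le; rewrite tot_cons lem_addl.
  exists (map (@pmon n) t); rewrite size_map size_tuple; split=> //.
  exact: edges_tuple (vA _ tA).
pose P (t : T) := valid t && (t \notin A).
have Pt0 : P t0 by rewrite /P vt0.
have [t Pt tmax] := Order.TotalTheory.arg_maxP (P := P) (fun t : T => wt t) Pt0.
have /andP[vt tA] := Pt.
have tmax' (t' : T) : valid t' -> (wt t < wt t')%O -> t' \in A.
  move=> vt' lt; apply/negPn/negP => nt'; move: lt; rewrite ltNge.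
  by rewrite [(_ <= _)%O]tmax // /P vt' nt'.
have RA' : Rg K (partial_pow (t |: A)) r.
  apply: IH.
    apply: leq_trans (_ : (#|~: (t |: A)| < #|~: A|)%N) _; last by rewrite -ltnS.
    apply: proper_card; rewrite properEneq setCS subsetUr andbT.
    by apply/eqP => /setP/(_ t); rewrite !inE eqxx tA.
  split=> [t'|t1 t']; first by rewrite !inE => /orP[/eqP ->|/vA].
  rewrite !inE => /orP[/eqP ->|t1A] vt' lt; first by rewrite tmax' // orbT.
  by rewrite (cA t1) ?orbT.
have eA' m : partial_pow (t |: A) m <-> adjoin (partial_pow A) (mon t) m.
  split=> [[h|[t' ]]|[[h|[t' t'A le]]|le]].
  - by left; left.
  - rewrite !inE => /orP[/eqP ->|t'A] le; first by right.
    by left; right; exists t'.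
  - by left.
  - by right; exists t' => //; rewrite !inE t'A orbT.
  - by right; exists t => //; rewrite !inE eqxx.
(* If the product is already present, adjoining it changes nothing. *)
have [ht|nt] := classic (partial_pow A (mon t)).
  apply: eq_Rg RA' => m; rewrite eA'; split=> [[//|le]|h]; last by left.
  by apply: upset_le le ht; apply: upset_partial_pow.
apply: (Rg_colon_adjoin (m := mon t)); first exact: upset_partial_pow.
  have et := edges_tuple vt.
  apply: (@leq_Rg _ _ _ s).
    rewrite (mdeg_tot et) size_map size_tuple; lia.
  apply: eq_Rg (Rg_Tq_s _ et _) => [m|]; last by rewrite size_map size_tuple.
  by split=> /(colon_partial_pow (conj vA cA) vt tA tmax' nt).
by apply: eq_Rg RA' => m; rewrite eA'.
Qed.

Lemma Rg_pow_succ : Rg K (pow_up e q.+1) r.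
Proof.
apply: eq_Rg (@Rg_partial_pow set0 _) => [m|].
  by split=> [[//|[t]]|h]; [rewrite inE|left].
by split=> t; [rewrite inE|move=> t'; rewrite inE].
Qed.

End Powers.

(** * The bound for all powers *)

Theorem theorem4p1 (K : fieldType) (n : nat) (e : rel 'I_n)
    (e_sym : ssrbool.symmetric e) (e_irr : irreflexive e)
    (e_nonempty : has_edge e [set: 'I_n])
    (e_no_isolated : forall x : 'I_n, exists y : 'I_n, e x y)
    (rho : {set 'I_n} -> nat)
    (rho_edgeless : forall U : {set 'I_n}, ~~ has_edge e U -> rho U = 0%N)
    (rho_reg : forall U : {set 'I_n}, has_edge e U ->
       reg (edge_ideal K (induced e U)) <= (rho U)%:Z + 1)
    (rho_mono : forall U U1 : {set 'I_n}, has_edge e U -> U1 \subset U ->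
       (rho U1 <= rho U)%N)
    (rho_vertex : forall U : {set 'I_n}, has_edge e U ->
       exists2 x : 'I_n, x \in U &
         (rho (U :\: closed_nbhd e U x) + 1 <= rho U)%N)
    (q : nat) (q_ge1 : (1 <= q)%N) :
  reg (ideal_pow (edge_ideal K e) q)
    <= 2 * q%:Z + (rho [set: 'I_n])%:Z - 1.
Proof.
have eT : adjW e [set: 'I_n] =2 e by move=> i j; rewrite /adjW /= !inE !andbT.
have RT M Z : edges e M -> Rg K (Tq e M Z) ((rho [set: 'I_n])%:Z + 1).
  move=> eM; have okM' : okM e [set: 'I_n] M.
    by move=> g /eM [i [j [eij ->]]]; exists i, j; rewrite eT.
  apply: eq_Rg (Rg_Tq e_sym rho_edgeless rho_reg rho_mono rho_vertex Z okM') => m.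
  by split=> -[h|[u [v [[l lM hl] le]]]]; (try by left); right; exists u, v;
    split=> //; exists l => //; apply: eq_ec hl => i j; rewrite eT.
(* Induction from q = 1, where I is the walk ideal with no edges of [M] and no variables; each
   further power raises the bound by 2. *)
have Rq : Rg K (pow_up e q) (2 * q%:Z + (rho [set: 'I_n])%:Z - 1).
  case: q q_ge1 => // {}q _; elim: q => [|q IH].
    apply: leq_Rg (eq_Rg _ (RT [::] (fun=> False) _)) => //; first by lia.
    move=> m; split=> [[[//]|[u [v [[l l0 hl] le]]]]|[l [sl el le]]].
      case: l l0 hl => [|g l /(_ g)] ; last by rewrite /= eqxx.
      move=> _ hl; exists [:: ed u v]; split=> // [g|].
        rewrite inE => /eqP ->; inversion hl; subst; by exists u, v.
      by rewrite /tot big_seq1.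
    case: l sl el le => [|g [|h l]] // _ el; rewrite /tot big_seq1.
    have [i [j [eij ->]]] := el g (mem_head _ _) => le; right; exists i, j.
    by split=> //; exists [::] => //; constructor.
  apply: (@Rg_pow_succ _ _ _ e_sym e_irr _ _ ((rho [set: 'I_n])%:Z + 1)).
  - by move=> M Z eM _; apply: RT.
  - lia.
  by apply: leq_Rg IH; lia.
(* The power of an edge monomial shows that I^q is nonzero, so [reg] is not the default value. *)
have [i _ /exists_inP [j _ eij]] := exists_inP e_nonempty.
apply: (reg_le (m := tot (nseq q (ed i j))) (ideal_pow_monid e q) _ Rq).
exists (nseq q (ed i j)); split; first by rewrite size_nseq.
  by move=> g /nseqP [-> _]; exists i, j.
exact: lepm_refl.
Qed.
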